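(* Let $(\Omega,\mathcal{A})$ be a measurable space, $\mathcal{P}$ a set of probability measures on $(\Omega,\mathcal{A})$, $P_0\in\mathcal{P}$, and $\alpha\in(0,1)$. Let $k:\mathcal{P}\to\mathbb{R}$ be a functional that is differentiable at $P_0$ with canonical gradient $\widetilde{k}\in T(P_0,\mathcal{P})$, and assume $\int\widetilde{k}^2\,dP_0\neq 0$. Write $\|\widetilde k\|=(\int \widetilde k^2\,dP_0)^{1/2}$. For $n\in\mathbb{N}$ let $X_1,\dots,X_n$ be the canonical projections on $\Omega^n$ and define the tests $$\varphi_{1n}=\mathbf{1}_{(u_{1-\alpha}\|\widetilde k\|,+\infty)}\Big(\tfrac{1}{\sqrt n}\sum_{i=1}^n\widetilde k(X_i)\Big),\qquad \varphi_{2n}=\mathbf{1}_{(u_{1-\alpha/2}\|\widetilde k\|,+\infty)}\Big(\Big|\tfrac{1}{\sqrt n}\sum_{i=1}^n\widetilde k(X_i)\Big|\Big).$$ Then for each sequence $(P_{t_n})_{n\in\mathbb{N}}\in\mathcal{F}$, with $\vartheta:=\lim_{n\to\infty}\sqrt n\,(k(P_{t_n})-k(P_0))$, we have $$\lim_{n\to\infty}E_{P_{t_n}^n}(\varphi_{1n})=\Phi\Big(\frac{\vartheta}{\|\widetilde k\|}-u_{1-\alpha}\Big),$$ $$\lim_{n\to\infty}E_{P_{t_n}^n}(\varphi_{2n})=\Phi\Big(\frac{\vartheta}{\|\widetilde k\|}-u_{1-\frac{\alpha}{2}}\Big)+\Phi\Big(-\frac{\vartheta}{\|\widetilde k\|}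-u_{1-\frac{\alpha}{2}}\Big).$$
   Context: Likelihood ratios: for probability measures $P,P_0$, $\frac{dP}{dP_0}$ denotes the $[0,\infty]$-valued likelihood ratio, i.e. the density of the $P_0$-absolutely continuous part of $P$, set equal to $\infty$ on a $P_0$-null set carrying the $P_0$-singular part of $P$. Differentiable curves: a map $(-\varepsilon,\varepsilon)\to\mathcal{P}$, $t\mapsto P_t$ (for some $\varepsilon>0$, taking the value $P_0$ at $t=0$) is an $L_2(P_0)$-differentiable curve in $\mathcal{P}$ with tangent $g\in L_2(P_0)$ if $\lim_{t\to0}\big\|\frac2t\big(\big(\frac{dP_t}{dP_0}\big)^{1/2}-1\big)-g\big\|_{L_2(P_0)}=0$ and $\lim_{t\to0}\frac1{t^2}P_t\big(\big\{\frac{dP_t}{dP_0}=\infty\big\}\big)=0$. Tangents: $K(P_0,\mathcal{P})$ is the set of tangents of all $L_2(P_0)$-differentiable curves in $\mathcal{P}$; $T(P_0,\mathcal{P})$ is the $L_2(P_0)$-closure of $K(P_0,\mathcal{P})$. $L_2^{(0)}(P_0)=\{h\in L_2(P_0):\int h\,dP_0=0\}$. Differentiable functionals: $k$ is differentiable at $P_0$ with gradient $\dot k\in L_2^{(0)}(P_0)$ if $\lim_{t\downarrow0}\frac1t(k(P_t)-k(P_0))=\int\dot k g\,dP_0$ for all $L_2(P_0)$-differentiable curves $t\mapsto P_t$ in $\mathcal{P}$ with tangent $g$. The canonical gradient $\widetilde k$ is the gradient belonging to $T(P_0,\mathcal{P})$ that has the smallest $L_2(P_0)$-norm among all gradients.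 The set $\mathcal{F}$: all sequences $(P_{t_n})_{n\in\mathbb{N}}$ such that $t_n\in[0,\infty)$, the limit $\lim_{n\to\infty}t_n\sqrt n$ exists in $(0,\infty)$, and there are $\varepsilon>0$ and an $L_2(P_0)$-differentiable curve $f:(-\varepsilon,\varepsilon)\to\mathcal{P}$ with $f(t_n)=P_{t_n}$ for all $n$ (in particular $t_n<\varepsilon$). $P^n$ is the $n$-fold product measure on $\Omega^n$; $\Phi$ is the standard normal distribution function and $u_{\beta}$ its $\beta$-quantile. *)

(* Defs.v *)
From HB Require Import structures.
From mathcomp Require Export all_boot all_order all_algebra.
From mathcomp Require Export all_classical all_reals all_analysis.
From mathcomp Require Export measurable_realfun.

Set Implicit Arguments.
Unset Strict Implicit.
Unset Printing Implicit Defensive.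
Import Order.TTheory GRing.Theory Num.Theory.
Import numFieldNormedType.Exports.

Local Open Scope classical_set_scope.
Local Open Scope ring_scope.

(* Two conventions hold throughout: elements of L2(P0) are represented by
   measurable real functions rather than by a.e.-classes, and a functional
   k on a set PP of probability measures is a total function on probability
   measures of which only the values on PP are used. *)

Section product_measure.
Context d (T : measurableType d) (R : realType).

Definition tuple_cons n (p : T * n.-tuple T) : n.+1.-tuple T :=
  [tuple of p.1 :: p.2].

Lemma measurable_tuple_cons n : measurable_fun setT (@tuple_cons n).
Proof. exact: measurable_cons. Qed.

HB.instance Definition _ n :=
  isMeasurableFun.Build _ _ _ _ (@tuple_cons n) (@measurable_tuple_cons n).

Fixpoint iid_prob (P : probability T R) (n : nat) :
    probability (n.-tuple T) R :=
  match n with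
  | 0 => dirac [tuple]
  | m.+1 => distribution (P \x iid_prob P m)%E (@tuple_cons m)
  end.

Lemma iid_prob_rect (P : probability T R) n (A : 'I_n -> set T) :
  (forall i, measurable (A i)) ->
  iid_prob P n [set x | forall i, A i (tnth x i)] = (\prod_(i < n) P (A i))%E.
Proof.
elim: n A => [|n IH] A mA.
  rewrite big_ord0 /= diracE mem_set//= => -[] //.
rewrite big_ord_recl /= /distribution /pushforward -IH//.
rewrite -product_measure1E//; last first.
  rewrite [X in measurable X](_ : _ = \bigcap_(i in setT) ((fun x : n.-tuple T => tnth x i) @^-1` A (lift ord0 i))).
    apply: fin_bigcap_measurable; first exact: finite_finset.
    move=> i _; rewrite -[X in measurable X]setTI; exact: measurable_tnth.
  by apply/seteqP; split => x /= h i; [move=> _; exact: h|exact: (h i I)].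
congr (_ _); apply/seteqP; split => -[a x] /=.
  move=> h; split; first exact: (h ord0).
  by move=> i; have := h (lift ord0 i); rewrite tnthS.
move=> [h0 h] i.
have [j ->|->] := unliftP ord0 i; [by rewrite tnthS; exact: h | exact: h0].
Qed.

End product_measure.

Section differentiable_curves.
Context d (T : measurableType d) (R : realType).
Implicit Types (P : probability T R) (PP : set (probability T R)).
Implicit Types (k : probability T R -> R) (g h : T -> R).

(* L is a version of the likelihood ratio dP/dP0: the set {L = +oo} is P0-null
   and carries the P0-singular part P (. `&` {L = +oo}) of P, and L is the
   density of the remaining, P0-absolutely continuous, part. *)
Definition is_likelihood_ratio P P0 (L : T -> \bar R) : Prop :=
  [/\ measurable_fun setT L,
      (forall x, 0 <= L x)%E,
      P0 [set x | L x = +oo%E] = 0%E &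
      forall A, measurable A ->
        P A = (\int[P0]_(x in A) L x + P (A `&` [set x | L x = +oo]))%E].

(* Only the values c t with `|t| < e are meaningful. Likelihood ratios are
   determined up to null sets of both measures, so the choice of the
   versions L t is immaterial. *)
Definition L2_differentiable_curve PP P0 (e : R) (c : R -> probability T R) g
    : Prop :=
  [/\ 0 < e,
      c 0 = P0,
      forall t, `|t| < e -> PP (c t),
      g \in Lfun P0 2%:E &
      exists L : R -> T -> \bar R,
        [/\ forall t, `|t| < e -> is_likelihood_ratio (c t) P0 (L t),
            ('N[P0]_2%:E[(fun x =>
                (2 / t)%:E * (L t x `^ 2^-1 - 1) - (g x)%:E)]
              @[t --> (0%R : R)^'] --> 0)%E &
            (((t ^+ 2)^-1)%:E * c t [set x | L t x = +oo]
              @[t --> (0%R : R)^'] --> 0)%E]].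

Definition tangent_set PP P0 : set (T -> R) :=
  [set g | exists e c, L2_differentiable_curve PP P0 e c g].

Definition tangent_space PP P0 : set (T -> R) :=
  [set h | h \in Lfun P0 2%:E /\
    forall eps : R, 0 < eps -> exists2 g, tangent_set PP P0 g &
      ('N[P0]_2%:E[EFin \o (h \- g)%R] < eps%:E)%E].

Definition centered_L2 P0 : set (T -> R) :=
  [set h | h \in Lfun P0 2%:E /\ \int[P0]_x h x = 0].

Definition is_gradient PP P0 k (kdot : T -> R) : Prop :=
  centered_L2 P0 kdot /\
  forall e c g, L2_differentiable_curve PP P0 e c g ->
    t^-1 * (k (c t) - k P0) @[t --> (0 : R)^'+] --> \int[P0]_x (kdot x * g x).

Definition differentiable_at PP P0 k : Prop :=
  exists kdot, is_gradient PP P0 k kdot.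

Definition is_canonical_gradient PP P0 k (ktilde : T -> R) : Prop :=
  [/\ is_gradient PP P0 k ktilde,
      tangent_space PP P0 ktilde &
      forall kdot, is_gradient PP P0 k kdot ->
        ('N[P0]_2%:E[EFin \o ktilde] <= 'N[P0]_2%:E[EFin \o kdot])%E].

(* Sequences are indexed from n = 1; the term Q 0 is unconstrained. *)
Definition local_sequences PP P0 : set (nat -> probability T R) :=
  [set Q | exists t : nat -> R,
    [/\ forall n, (0 < n)%N -> 0 <= t n,
        exists2 l : R, 0 < l & t n * Num.sqrt n%:R @[n --> \oo] --> l &
        exists e c g, L2_differentiable_curve PP P0 e c g /\
          forall n, (0 < n)%N -> t n < e /\ c (t n) = Q n]].

Definition L2norm P0 h : R := Num.sqrt (\int[P0]_x (h x ^+ 2)).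

End differentiable_curves.

Section normal.
Context (R : realType).

Definition Phi (x : R) : R := fine (normal_prob 0 1 `]-oo, x]).

Definition normal_quantile (beta : R) : R := inf [set x | beta <= Phi x].

End normal.

Section tests.
Context d (T : measurableType d) (R : realType).
Variables (P0 : probability T R) (alpha : R) (ktilde : T -> R).

Definition test_stat n (x : n.-tuple T) : R :=
  (Num.sqrt n%:R)^-1 * \sum_(i < n) ktilde (tnth x i).

Definition phi1 n (x : n.-tuple T) : R :=
  \1_(`]normal_quantile (1 - alpha) * L2norm P0 ktilde, +oo[ : set R)
    (test_stat x).

Definition phi2 n (x : n.-tuple T) : R :=
  \1_(`]normal_quantile (1 - alpha / 2) * L2norm P0 ktilde, +oo[ : set R)
    `|test_stat x|.

End tests.

(* Main.v *)
Require Import Defs.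
From HB Require Import structures.
From mathcomp Require Import all_boot all_order all_algebra.
From mathcomp Require Import all_classical all_reals all_analysis.
From mathcomp Require Import measurable_realfun.
From mathcomp Require Import ring lra.
Set Implicit Arguments.
Unset Strict Implicit.
Unset Printing Implicit Defensive.
Import Order.TTheory GRing.Theory Num.Theory.
Import numFieldNormedType.Exports.
Local Open Scope classical_set_scope.
Local Open Scope ring_scope.

(* Normalise X := ktilde / sigma and regard the average of f (x + X / sqrt n)
   under Q n as an operator U n acting on functions f of x: the expectation of
   f (S n) under the n-fold product measure is the n-th iterate of U n at 0.
   Writing the density of Q n as (1 + t n / 2 * w) ^+ 2 with w close to the
   tangent g in L2 (P0), a second order Taylor expansion gives, uniformly in x,
     n (U n f x - f x) = l <X, g> f' x + f'' x / 2 + o(1),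
   because X has mean 0 and variance 1 under P0 and t n * sqrt n tends to l.
   The operators V n averaging over a normal law with mean l <X, g> / n and
   variance 1 / n have the same expansion, commute with U n, and their n-th
   iterate is explicit, so the n-th iterates of U n and V n have the same limit
   (Trotter's proof of the central limit theorem, carried out directly under
   the alternatives, without contiguity).  Logistic functions, all of whose
   derivatives are bounded polynomials in the function itself, serve as smooth
   approximations of the indicator functions of the tests. *)

(** * Logistic functions as smooth test functions *)

(** Only second moments of X and of the tangent are available, so a cubic Taylor remainder cannot be
    integrated directly. Every remainder is therefore bounded by the minimum of an integrable
    majorant free of n and of a term that vanishes pointwise as n grows; dominated convergence then
    does the work of a Lindeberg condition. These bounds see f only through its Taylor constant,
    whence the uniformity in x on which the comparison of iterates rests. The measure Q n may have a
    singular part, and its density is controlled only through its square root. Subtracting f x times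
    the identity of total masses leaves integrals of the increment f (x + X / sqrt n) - f x alone:
    expanding the square, the constant term yields the variance part, the cross term the drift, and
    the quadratic term is negligible since the increment is bounded and tends to 0. The singular
    mass is o(1/n), hence harmless after n steps. The gradient property along the curve gives ϑ = l
    <ktilde, g>, so the drift l <X, g> is ϑ / sigma. The two-sided test is the sum of two one-sided
    ones, for X and for -X. *)

Section logistic.
Context {R : realType}.
Implicit Types (x h K b C : R) (f : R -> R).

(** A crude Taylor step by the mean value theorem: the constant is kept instead of being divided by
    [m.+1]. Repeated use turns one bound on a derivative into remainder bounds of all lower
    derivatives. *)
Lemma mvt_pow_bound (F dF : R -> R) (c : R) (m : nat) : F 0 = 0 ->
  (forall h, is_derive h 1 F (dF h)) ->
  (forall h, `|dF h| <= c * `|h| ^+ m) ->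
  forall h, `|F h| <= c * `|h| ^+ m.+1.
Proof.
move=> F0 dF_ b h.
have cF : continuous F.
  move=> x; apply: differentiable_continuous; apply/derivable1_diffP.
  by have [] := dF_ x.
have c0 : 0 <= c.
  have := b 1; rewrite normr1 expr1n mulr1; exact: le_trans.
have [h0|h0] := leP 0 h.
- have [z] := MVT_segment h0 (fun x _ => dF_ x)
    (continuous_subspaceT cF).
  rewrite in_itv/= => /andP[z0 zh]; rewrite F0 !subr0 => ->.
  rewrite normrM exprSr mulrA; apply: ler_wpM2r => //.
  apply: le_trans (b z) _; apply: ler_wpM2l => //.
  by apply: lerXn2r; rewrite ?nnegrE// !ger0_norm.
- have [z] := MVT_segment (ltW h0) (fun x _ => dF_ x)
    (continuous_subspaceT cF).
  rewrite in_itv/= => /andP[z0 zh]; rewrite F0 !sub0r => Fh.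
  rewrite -normrN Fh normrM normrN exprSr mulrA; apply: ler_wpM2r => //.
  apply: le_trans (b z) _; apply: ler_wpM2l => //.
  by apply: lerXn2r; rewrite ?nnegrE// !ler0_norm ?lerN2 ?(ltW h0).
Qed.

Definition logistic x : R := (1 + expR (- x))^-1.

Let den_gt0 x : 0 < 1 + expR (- x).
Proof. by rewrite ltr_pwDl// expR_ge0. Qed.

Lemma logistic_gt0 x : 0 < logistic x.
Proof. by rewrite invr_gt0. Qed.

Lemma logistic_lt1 x : logistic x < 1.
Proof. by rewrite invf_lt1// ltrDl expR_gt0. Qed.

Lemma logisticN x : logistic (- x) = 1 - logistic x.
Proof.
rewrite /logistic opprK expRN.
have e0 : expR x != 0 by rewrite gt_eqF// expR_gt0.
have e1 : 1 + expR x != 0 by rewrite gt_eqF// ltr_pwDl// expR_ge0.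
by field; rewrite e0 [expR x + 1]addrC e1.
Qed.

(** Follows from [1 + x <= expR x]. This slow rate suffices: [logistic_sandwich] uses it at x = M
    for an error [M^-1]. *)
Lemma logistic_le x : 0 < x -> 1 - logistic x <= x^-1.
Proof.
move=> x0; rewrite -logisticN /logistic opprK lef_pV2 ?posrE ?ltr_pwDl ?expR_ge0//.
by have := expR_ge1Dx x; lra.
Qed.

Lemma logistic_homo : {homo logistic : x y / x <= y}.
Proof. by move=> x y xy; rewrite lef_pV2 ?posrE// lerD2l ler_expR lerN2. Qed.

Definition logistic1 x : R := logistic x - logistic x ^+ 2.
Definition logistic2 x : R := logistic1 x * (1 - 2 * logistic x).
Definition logistic3 x : R :=
  logistic2 x * (1 - 2 * logistic x) - 2 * logistic1 x ^+ 2.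

Lemma is_derive_logistic x : is_derive x 1 logistic (logistic1 x).
Proof.
have dN : is_derive x 1 (fun y : R => 1 + expR (- y)) (- expR (- x)).
  apply: is_derive_eq.
  by rewrite /GRing.scale/=; ring.
apply: is_derive_eq; first by apply: is_deriveV; rewrite gt_eqF.
rewrite /logistic1 /logistic /GRing.scale/=.
have := den_gt0 x; set e := expR _ => e0.
have {}e0 : 1 + e != 0 by rewrite gt_eqF.
by field.
Qed.

Lemma is_derive_logistic1 x : is_derive x 1 logistic1 (logistic2 x).
Proof.
have dl := is_derive_logistic x.
have d2 : is_derive x 1 (fun y : R => logistic y * logistic y)
   (logistic x *: logistic1 x + logistic x *: logistic1 x) := is_deriveM dl dl.
have -> : logistic1 = (fun y => logistic y - logistic y * logistic y).
  by apply/funext => y; rewrite /logistic1 expr2.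
apply: is_derive_eq.
by rewrite /logistic2 /logistic1 /GRing.scale/=; ring.
Qed.

Lemma is_derive_logistic2 x : is_derive x 1 logistic2 (logistic3 x).
Proof.
have dl := is_derive_logistic x.
have dl1 := is_derive_logistic1 x.
have d2 : is_derive x 1 (fun y : R => 1 - 2 * logistic y) (- 2 * logistic1 x).
  apply: is_derive_eq.
  by rewrite /GRing.scale/=; ring.
have := is_deriveM dl1 d2 => /is_derive_eq; apply.
by rewrite /logistic3 /logistic2 /logistic1 /GRing.scale/=; ring.
Qed.

Let l01 x : 0 <= logistic x <= 1.
Proof. by rewrite !ltW ?logistic_gt0 ?logistic_lt1. Qed.

Lemma logistic1_bound x : `|logistic1 x| <= 1.
Proof. by have := l01 x; rewrite /logistic1 ler_norml; nra. Qed.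

Let l12_bound x : `|1 - 2 * logistic x| <= 1.
Proof. by have := l01 x; rewrite ler_norml; lra. Qed.

Lemma logistic2_bound x : `|logistic2 x| <= 1.
Proof. by rewrite /logistic2 normrM mulr_ile1// logistic1_bound. Qed.

Lemma logistic3_bound x : `|logistic3 x| <= 3.
Proof.
have := logistic1_bound x; have := logistic2_bound x; have := l12_bound x.
rewrite /logistic3 !ler_norml => /andP[a1 a2] /andP[b1 b2] /andP[c1 c2].
by apply/andP; split; nra.
Qed.

(* [f1] and [f2] play the role of the first two derivatives of [f]. *)
Record taylor2 C (f f1 f2 : R -> R) : Prop := Taylor2 {
  taylor2_ge0 : 0 <= C ;
  taylor2_continuous : continuous f ;
  taylor2_itv : forall x, 0 <= f x <= 1 ;
  taylor2_bound1 : forall x, `|f1 x| <= C ;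
  taylor2_bound2 : forall x, `|f2 x| <= C ;
  taylor2_rem0 : forall x h, `|f (x + h) - f x| <= C * `|h| ;
  taylor2_rem1 : forall x h, `|f (x + h) - f x - f1 x * h| <= C * h ^+ 2 ;
  taylor2_rem2 : forall x h,
    `|f (x + h) - f x - f1 x * h - f2 x * h ^+ 2 / 2| <= C * `|h| ^+ 3 ;
  taylor2_lip2 : forall x h, `|f2 (x + h) - f2 x| <= C * `|h| }.

(** The constant 3 is the bound on [logistic3]. The remainders come from [mvt_pow_bound], applied
    along the chain of derivatives; those that hold with constant 1 are weakened to 3. *)
Lemma taylor2_logistic : taylor2 3 logistic logistic1 logistic2.
Proof.
have sh (f f' : R -> R) (x h : R) : (forall y : R, is_derive y 1 f (f' y)) ->
    is_derive h 1 (fun h => f (x + h)) (f' (x + h)).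
  move=> df; have -> : (fun h => f (x + h)) = f \o (+%R x) by [].
  rewrite -[f' _]mulr1; apply: is_derive1_comp.
  by apply: is_derive_eq; rewrite add0r.
have l2 x h : `|logistic2 (x + h) - logistic2 x| <= 3 * `|h|.
  rewrite -[`|h|]expr1.
  apply: (@mvt_pow_bound (fun h => logistic2 (x + h) - logistic2 x)
    (fun h => logistic3 (x + h)) 3 0%N).
  - by rewrite addr0 subrr.
  - move=> k; have := sh _ _ x k is_derive_logistic2 => d.
    by apply: is_derive_eq; rewrite subr0.
  - by move=> k; rewrite expr0 mulr1 logistic3_bound.
have l1 x h : `|logistic1 (x + h) - logistic1 x - logistic2 x * h|
    <= 3 * `|h| ^+ 2.
  apply: (@mvt_pow_bound
    (fun h => logistic1 (x + h) - logistic1 x - logistic2 x * h)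
    (fun h => logistic2 (x + h) - logistic2 x) 3 1%N).
  - by rewrite addr0 subrr mulr0 subr0.
  - move=> k; have := sh _ _ x k is_derive_logistic1 => d.
    by apply: is_derive_eq; rewrite /GRing.scale/=; ring.
  - by move=> k; rewrite expr1 l2.
have r0 x h : `|logistic (x + h) - logistic x| <= 1 * `|h|.
  rewrite -[`|h|]expr1.
  apply: (@mvt_pow_bound (fun h => logistic (x + h) - logistic x)
    (fun h => logistic1 (x + h)) 1 0%N).
  - by rewrite addr0 subrr.
  - move=> k; have := sh _ _ x k is_derive_logistic => d.
    by apply: is_derive_eq; rewrite subr0.
  - by move=> k; rewrite expr0 mulr1 logistic1_bound.
have q1 x h : `|logistic1 (x + h) - logistic1 x| <= 1 * `|h|.
  rewrite -[`|h|]expr1.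
  apply: (@mvt_pow_bound (fun h => logistic1 (x + h) - logistic1 x)
    (fun h => logistic2 (x + h)) 1 0%N).
  - by rewrite addr0 subrr.
  - move=> k; have := sh _ _ x k is_derive_logistic1 => d.
    by apply: is_derive_eq; rewrite subr0.
  - by move=> k; rewrite expr0 mulr1 logistic2_bound.
split => //.
- move=> x; apply: differentiable_continuous; apply/derivable1_diffP.
  by have [] := is_derive_logistic x.
- by move=> x; rewrite (le_trans (logistic1_bound x))//; lra.
- by move=> x; rewrite (le_trans (logistic2_bound x))//; lra.
- by move=> x h; rewrite (le_trans (r0 x h))// ler_wpM2r//; lra.
- move=> x h; apply: (@le_trans _ _ (1 * `|h| ^+ 2)); last first.
    by rewrite real_normK ?num_real// ler_wpM2r ?sqr_ge0//; lra.
  apply: (@mvt_pow_bound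
    (fun h => logistic (x + h) - logistic x - logistic1 x * h)
    (fun h => logistic1 (x + h) - logistic1 x) 1 1%N).
  - by rewrite addr0 subrr mulr0 subr0.
  - move=> k; have := sh _ _ x k is_derive_logistic => d.
    by apply: is_derive_eq; rewrite /GRing.scale/=; ring.
  - by move=> k; rewrite expr1 q1.
- move=> x h; apply: (@mvt_pow_bound
    (fun h => logistic (x + h) - logistic x - logistic1 x * h
       - logistic2 x * h ^+ 2 / 2)
    (fun h => logistic1 (x + h) - logistic1 x - logistic2 x * h) 3 2%N).
  + by rewrite addr0 subrr !mulr0 expr0n/= mulr0 mul0r !subr0.
  + move=> k; have d := sh _ _ x k is_derive_logistic.
    have -> : (fun h => logistic (x + h) - logistic x - logistic1 x * h
       - logistic2 x * h ^+ 2 / 2) = (fun h : R => logistic (x + h) -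
       logistic x - logistic1 x * h - (logistic2 x / 2) * (h * h)).
      by apply/funext => y; rewrite expr2; ring.
    have dm : is_derive k 1 (fun h : R => h * h) (k *: (1:R) + k *: (1:R)).
      exact: is_deriveM.
    by apply: is_derive_eq; rewrite /GRing.scale/=; field.
  + by move=> k; rewrite l1.
Qed.

(** Rescaling multiplies the bounds by K, K^2 or K^3; [1 <= K] makes K^3 the largest, so a single
    constant still covers all fields. *)
Lemma taylor2_affine C K b (f f1 f2 : R -> R) : 1 <= K ->
  taylor2 C f f1 f2 ->
  taylor2 (C * K ^+ 3) (fun x => f (K * x + b))
    (fun x => K * f1 (K * x + b)) (fun x => K ^+ 2 * f2 (K * x + b)).
Proof.
move=> K1 [C0 fc f01 b1 b2 r0 r1 r2 l2].
have K0 : 0 <= K by lra.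
have KE x h : K * (x + h) + b = K * x + b + K * h by ring.
have K2 : 1 <= K ^+ 2 by rewrite exprn_ege1.
have K13 : K <= K ^+ 3 by rewrite exprSr; nra.
have K23 : K ^+ 2 <= K ^+ 3 by rewrite (exprSr K 2); nra.
split => //.
- by rewrite mulr_ge0// exprn_ge0.
- move=> x; apply: (@continuous_comp _ _ _ (fun x => K * x + b) f); last exact: fc.
  apply: cvgD; last exact: cvg_cst.
  by apply: cvgM; [exact: cvg_cst|exact: cvg_id].
- move=> x; rewrite normrM (ger0_norm K0) mulrC.
  by apply: ler_pM.
- move=> x; rewrite normrM (ger0_norm (exprn_ge0 _ K0)) mulrC.
  by apply: ler_pM => //; rewrite exprn_ge0.
- move=> x h; rewrite KE (le_trans (r0 _ _))// normrM (ger0_norm K0) mulrA.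
  by rewrite ler_wpM2r// ler_wpM2l.
- move=> x h; rewrite KE [K * _ * h]mulrAC [_ * f1 _]mulrC (le_trans (r1 _ _))//.
  by rewrite exprMn mulrA ler_wpM2r ?sqr_ge0// ler_wpM2l.
- move=> x h; rewrite KE [K * _ * h]mulrAC [_ * f1 _]mulrC.
  rewrite [K ^+ 2 * _ * _]mulrAC -exprMn [_ * f2 _]mulrC.
  rewrite (le_trans (r2 _ _))//.
  by rewrite normrM (ger0_norm K0) exprMn mulrA.
- move=> x h; rewrite -mulrBr normrM KE (ger0_norm (exprn_ge0 _ K0)).
  apply: le_trans (ler_wpM2l _ (l2 _ _)) _; first by rewrite exprn_ge0.
  by rewrite normrM (ger0_norm K0) le_eqVlt; apply/orP; left; apply/eqP; ring.
Qed.

End logistic.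

(** * Averaging operators *)

Section density.
Context d (T : measurableType d) (R : realType).
Variables (mu nu : {measure set T -> \bar R}) (E : set T) (g : T -> R).
Hypotheses (mE : measurable E) (mg : measurable_fun setT g)
  (g0 : forall x, 0 <= g x).
Hypothesis nuE : forall A, measurable A -> A `<=` E ->
  nu A = (\int[mu]_(x in A) (g x)%:E)%E.

Import HBNNSimple.

Let ge0_integral_density_nnsfun (h : {nnsfun T >-> R}) :
  (\int[nu]_(x in E) (h x)%:E = \int[mu]_(x in E) ((h x)%:E * (g x)%:E))%E.
Proof.
transitivity (\int[nu]_(x in E)
    (\sum_(y \in range h) (y * \1_(h @^-1` [set y]) x)%:E))%E.
  by apply: eq_integral => t tE; rewrite fimfunE -fsumEFin.
have mind r : measurable_fun E (fun x => (r * \1_(h @^-1` [set r]) x)%:E).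
  by apply: (measurable_comp measurableT) => //; exact: measurable_funM.
have mgE : measurable_fun E (EFin \o g).
  by apply/measurable_EFinP; exact: measurable_funTS.
rewrite ge0_integral_fsum//; last by move=> y x _; exact: nnfun_muleindic_ge0.
transitivity (\int[mu]_(x in E)
    (\sum_(y \in range h) ((y * \1_(h @^-1` [set y]) x)%:E * (g x)%:E)))%E;
    last first.
  apply: eq_integral => x xE.
  rewrite -ge0_mule_fsuml => [|y]; last exact: nnfun_muleindic_ge0.
  by rewrite fsumEFin // -(fimfunE _ x).
rewrite ge0_integral_fsum//; last 2 first.
- by move=> y; apply: emeasurable_funM.
- move=> y x _; apply: mule_ge0; first exact: nnfun_muleindic_ge0.
  by rewrite lee_fin.
apply: eq_fsbigr => r; rewrite inE => -[t _ <-].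
under eq_integral do rewrite EFinM.
rewrite integralZl_indic_nnsfun => //.
under [RHS]eq_integral do rewrite EFinM -muleA.
rewrite ge0_integralZl//.
- under [in RHS]eq_integral do rewrite muleC.
  rewrite [in RHS](eq_integral ((EFin \o g) \_ (h @^-1` [set h t])))//; last first.
    by move=> x xE; rewrite -[in RHS]/(EFin \o g) epatch_indic.
  rewrite -integral_mkcondr integral_indic// setIC nuE//.
- by apply: emeasurable_funM => //; exact/measurable_EFinP.
- by move=> x Ex; rewrite mule_ge0 ?lee_fin.
- by rewrite lee_fin.
Qed.

(** The usual passage from simple functions to monotone limits. The density is prescribed on E only,
    because a measure with a singular part has one just off the set carrying that part. *)
Lemma ge0_integral_density (f : T -> \bar R) :
  measurable_fun setT f -> (forall x, 0 <= f x)%E ->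
  (\int[nu]_(x in E) f x = \int[mu]_(x in E) (f x * (g x)%:E))%E.
Proof.
move=> mf f0; pose h := nnsfun_approx measurableT mf.
have hf x : (h n x)%:E @[n --> \oo] --> f x.
  by apply: cvg_nnsfun_approx => // y _; exact: f0.
have hnd x m n : (m <= n)%N -> ((h m x)%:E <= (h n x)%:E)%E.
  by move=> mn; rewrite lee_fin; exact/lefP/nd_nnsfun_approx.
have cnu : (\int[nu]_(x in E) (h n x)%:E @[n --> \oo] -->
    \int[nu]_(x in E) f x)%E.
  rewrite (@eq_integral _ _ _ nu E (fun x => limn (fun n => (h n x)%:E)) f).
    apply: cvg_monotone_convergence => //.
    - by move=> n; apply/measurable_EFinP; exact: measurable_funTS.
    - by move=> n x _; rewrite lee_fin.
    - by move=> x _ m n mn; exact: hnd.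
  by move=> x _; apply/esym/cvg_lim.
have cmu : (\int[mu]_(x in E) ((h n x)%:E * (g x)%:E) @[n --> \oo] -->
    \int[mu]_(x in E) (f x * (g x)%:E))%E.
  rewrite (@eq_integral _ _ _ mu E
    (fun x => limn (fun n => (h n x)%:E * (g x)%:E)%E)).
    apply: cvg_monotone_convergence => //.
    - by move=> n; apply: emeasurable_funM; apply/measurable_EFinP;
        exact: measurable_funTS.
    - by move=> n x _; rewrite mule_ge0// lee_fin.
    - by move=> x _ m n mn; rewrite lee_wpmul2r ?lee_fin//; exact: hnd.
  by move=> x _; apply/esym/cvg_lim => //; exact: cvgeZr.
apply: (cvg_unique _ cnu) => //.
by move: cmu; under eq_fun do rewrite -ge0_integral_density_nnsfun.
Qed.

End density.

Section averaging.
Context {R : realType}.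

(** A class that averaging preserves and in which integrability and nonnegativity are automatic, so
    that Tonelli and [fine] can be used freely on all iterates. *)
Definition unitfun d (T : measurableType d) (f : T -> R) : Prop :=
  measurable_fun setT f /\ forall x, 0 <= f x <= 1.

Lemma bounded_fun_integrable d (T : measurableType d)
    (mu : probability T R) (f : T -> R) (M : R) :
  measurable_fun setT f -> (forall x, `|f x| <= M) ->
  mu.-integrable setT (EFin \o f).
Proof.
move=> mf fM; apply: measurable_bounded_integrable => //.
- exact: le_lt_trans (probability_le1 _ _) (ltry _).
- exists M; split; first exact: num_real.
  by move=> N MN x _ /=; rewrite (le_trans (fM x))// ltW.
Qed.

Lemma unitfun_integrable d (T : measurableType d)
    (mu : probability T R) (f : T -> R) :
  unitfun f -> mu.-integrable setT (EFin \o f).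
Proof.
move=> [mf f01]; apply: (@bounded_fun_integrable _ _ _ _ 1) => // x.
by have /andP[? ?] := f01 x; rewrite ger0_norm.
Qed.

Lemma Rintegral_unitfunE d (T : measurableType d)
    (mu : probability T R) (f : T -> R) :
  unitfun f -> (\int[mu]_x f x)%:E = (\int[mu]_x (f x)%:E)%E.
Proof.
move=> uf; rewrite fineK//; apply: integrable_fin_num => //.
exact: unitfun_integrable.
Qed.

Lemma Rintegral_probability_cst d (T : measurableType d)
    (mu : probability T R) (r : R) : \int[mu]_x r = r.
Proof.
rewrite Rintegral_cst// -[RHS]mulr1; congr (_ * _).
exact: (congr1 fine (probability_setT mu)).
Qed.

Lemma Rintegral_unitfun_itv d (T : measurableType d)
    (mu : probability T R) (f : T -> R) :
  unitfun f -> 0 <= \int[mu]_x f x <= 1.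
Proof.
move=> uf; have if_ := unitfun_integrable mu uf; case: uf => [mf f01].
rewrite Rintegral_ge0/=; last by move=> x _; case/andP: (f01 x).
rewrite -[leRHS](Rintegral_probability_cst mu 1); apply: le_Rintegral => //.
  by apply: (@bounded_fun_integrable _ _ _ _ 1) => // x; rewrite normr1.
by move=> x _; case/andP: (f01 x).
Qed.

Lemma Rintegral_close d (T : measurableType d)
    (mu : probability T R) (f g : T -> R) (e : R) :
  unitfun f -> unitfun g -> (forall x, `|f x - g x| <= e) ->
  `|\int[mu]_x f x - \int[mu]_x g x| <= e.
Proof.
move=> uf ug fge.
have if_ := unitfun_integrable mu uf; have ig := unitfun_integrable mu ug.
rewrite -RintegralB//.
have ifg : mu.-integrable setT (EFin \o (fun x => f x - g x)).
  apply: (@bounded_fun_integrable _ _ _ _ e) => //.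
  by apply: measurable_funB; [case: uf|case: ug].
rewrite (le_trans (le_normr_Rintegral _ _))//.
rewrite -[leRHS](Rintegral_probability_cst mu e); apply: le_Rintegral => //.
- apply: (@bounded_fun_integrable _ _ _ _ e) => //; last by move=> x; rewrite normr_id.
  by apply: measurableT_comp => //; apply: measurable_funB; [case: uf|case: ug].
- apply: (@bounded_fun_integrable _ _ _ _ e) => // x.
  (* The bound at [point] shows that e is nonnegative. *)
  by rewrite ger0_norm// (le_trans _ (fge point)).
Qed.

Definition avg d (T : measurableType d) (mu : probability T R) (Y : T -> R)
  (f : R -> R) (x : R) : R := \int[mu]_w f (x + Y w).

Section avg_theory.
Context d (T : measurableType d) (mu : probability T R) (Y : T -> R).
Hypothesis mY : measurable_fun setT Y.

Lemma unitfun_shift (f : R -> R) (x : R) :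
  unitfun f -> unitfun (fun w => f (x + Y w)).
Proof.
move=> [mf f01]; split => //.
by apply: measurableT_comp => //; exact: measurable_funD.
Qed.

Lemma avgE (f : R -> R) x : unitfun f ->
  (avg mu Y f x)%:E = (\int[mu]_w (f (x + Y w))%:E)%E.
Proof. by move=> uf; rewrite Rintegral_unitfunE//; exact: unitfun_shift. Qed.

(** Measurability in the starting point is that of a partial integral of a jointly measurable
    nonnegative function. *)
Lemma unitfun_avg (f : R -> R) : unitfun f -> unitfun (avg mu Y f).
Proof.
move=> uf; split; last first.
  by move=> x; apply: Rintegral_unitfun_itv; exact: unitfun_shift.
have [mf f01] := uf.
apply/measurable_EFinP.
rewrite (_ : _ \o _ = fun x => (\int[mu]_w (f (x + Y w))%:E)%E); last first.
  by apply/funext => x /=; rewrite avgE.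
pose F := fun p : measurableTypeR R * T => (f (p.1 + Y p.2))%:E.
have mF : measurable_fun setT F.
  apply/measurable_EFinP; apply: measurableT_comp => //.
  by apply: measurable_funD => //; exact: measurableT_comp.
have F0 p : (0 <= F p)%E by rewrite lee_fin; case/andP: (f01 (p.1 + Y p.2)).
exact: (@measurable_fun_fubini_tonelli_F _ _ _ _ _ mu F mF F0).
Qed.

Lemma avg_close (f g : R -> R) (e : R) : unitfun f -> unitfun g ->
  (forall x, `|f x - g x| <= e) -> forall x, `|avg mu Y f x - avg mu Y g x| <= e.
Proof. by move=> uf ug fg x; apply: Rintegral_close => //; exact: unitfun_shift. Qed.

Lemma unitfun_iter_avg (f : R -> R) n :
  unitfun f -> unitfun (iter n (avg mu Y) f).
Proof. by move=> uf; elim: n => //= n IH; exact: unitfun_avg. Qed.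

End avg_theory.

(** Both sides average f over x + Y1 + Y2 under the product law, in the two orders of Tonelli's
    theorem. *)
Lemma avgC d1 d2 (T1 : measurableType d1) (T2 : measurableType d2)
    (mu1 : probability T1 R) (mu2 : probability T2 R) (Y1 : T1 -> R)
    (Y2 : T2 -> R) (f : R -> R) :
  measurable_fun setT Y1 -> measurable_fun setT Y2 -> unitfun f ->
  avg mu1 Y1 (avg mu2 Y2 f) = avg mu2 Y2 (avg mu1 Y1 f).
Proof.
move=> m1 m2 uf; apply/funext => x; apply: EFin_inj.
rewrite !avgE//; try exact: unitfun_avg.
under eq_integral do rewrite avgE//.
under [RHS]eq_integral do rewrite avgE//.
have [mf f01] := uf.
rewrite (@fubini_tonelli _ _ _ _ _ mu1 mu2
  (fun p => (f (x + Y1 p.1 + Y2 p.2))%:E))/=.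
- by apply: eq_integral => w _; apply: eq_integral => v _; rewrite addrAC.
- apply/measurable_EFinP; apply: measurableT_comp => //.
  apply: measurable_funD; last exact: measurableT_comp.
  by apply: measurable_funD => //; exact: measurableT_comp.
- by move=> p; rewrite lee_fin; case/andP: (f01 (x + Y1 p.1 + Y2 p.2)).
Qed.

(* Since the two operators commute and are contractions, the [n]-th iterates
   differ by at most [n] times the one-step difference. *)
Lemma iter_avg_close d1 d2 (T1 : measurableType d1) (T2 : measurableType d2)
    (mu1 : probability T1 R) (mu2 : probability T2 R) (Y1 : T1 -> R)
    (Y2 : T2 -> R) (f : R -> R) (e : R) (n : nat) :
  measurable_fun setT Y1 -> measurable_fun setT Y2 -> unitfun f ->
  (forall x, `|avg mu1 Y1 f x - avg mu2 Y2 f x| <= e) ->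
  forall x, `|iter n (avg mu1 Y1) f x - iter n (avg mu2 Y2) f x| <= n%:R * e.
Proof.
move=> m1 m2; elim: n f => [|n IH] f uf fe x.
  by rewrite subrr normr0 mul0r.
have u1 := unitfun_avg mu1 m1 uf; have u2 := unitfun_avg mu2 m2 uf.
rewrite !iterSr (le_trans (ler_distD (iter n (avg mu1 Y1) (avg mu2 Y2 f) x) _ _))//.
rewrite -natr1 mulrDl mul1r addrC lerD//.
  (* The intermediate term applies the second operator once and then the first one n times. The
     induction hypothesis is used for [avg mu2 Y2 f]: after commuting, its one-step difference is
     the second operator applied to the one-step difference of f, hence still at most e. *)
  apply: IH => // y; rewrite avgC//.
  exact: avg_close.
elim: n {IH} (avg mu1 Y1 f) (avg mu2 Y2 f) u1 u2 fe x => [|n IH] g h ug uh gh x //=.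
by apply: avg_close => //; [exact: unitfun_iter_avg..|move=> y; exact: IH].
Qed.

End averaging.

Section iid_average.
Context d (T : measurableType d) (R : realType) (P : probability T R).
Variable Y : T -> R.
Hypothesis mY : measurable_fun setT Y.

Lemma measurable_tuple_sum n :
  measurable_fun setT (fun x : n.-tuple T => \sum_(i < n) Y (tnth x i)).
Proof.
apply: measurable_sum => i; apply: measurableT_comp => //.
exact: measurable_tnth.
Qed.

(** The outermost averaging is the integral over the first coordinate, which matches the recursion
    defining [iid_prob]. The induction keeps x general because the starting point absorbs the first
    summand. *)
Lemma iter_avg_iid n (f : R -> R) (x : R) : unitfun f ->
  iter n (avg P Y) f x =
  \int[iid_prob P n]_w f (x + \sum_(i < n) Y (tnth w i)).
Proof.
move=> uf.
have us m y : unitfun (fun w : m.-tuple T => f (y + \sum_(i < m) Y (tnth w i))).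
  apply: unitfun_shift => //; exact: measurable_tuple_sum.
elim: n x => [|n IH] x.
  rewrite /Rintegral /= integral_dirac//.
    by rewrite /dirac indicE in_setT mul1e/= big_ord0 addr0.
  by apply/measurable_EFinP; case: (us 0%N x).
rewrite iterS; apply: EFin_inj; rewrite avgE//; last exact: unitfun_iter_avg.
rewrite Rintegral_unitfunE; last exact: us.
have [mf f01] := uf.
pose F (p : T * n.-tuple T) :=
  (f (x + Y p.1 + \sum_(i < n) Y (tnth p.2 i)))%:E.
have mF : measurable_fun setT F.
  apply/measurable_EFinP; apply: measurableT_comp => //.
  apply: measurable_funD.
    by apply: measurable_funD => //; exact: measurableT_comp.
  apply: (@measurableT_comp _ _ _ _ _ _
    (fun w : n.-tuple T => \sum_(i < n) Y (tnth w i)) _ snd) => //.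
  exact: measurable_tuple_sum.
have F0 p : (0 <= F p)%E.
  by rewrite lee_fin; case/andP: (f01 (x + Y p.1 + \sum_(i < n) Y (tnth p.2 i))).
transitivity (\int[(P \x iid_prob P n)%E]_p F p)%E.
  rewrite fubini_tonelli1//; apply: eq_integral => a _.
  by rewrite IH Rintegral_unitfunE//; exact: us.
rewrite [RHS]ge0_integral_distribution; last 2 first.
- by apply/measurable_EFinP; case: (us n.+1 x).
- move=> w; rewrite lee_fin.
  by case/andP: (f01 (x + \sum_(i < n.+1) Y (tnth w i))).
apply: eq_integral => p _; rewrite /F /=; congr (f _)%:E.
rewrite big_ord_recl addrA; congr (_ + _).
by apply: eq_bigr => i _; rewrite tnthS.
Qed.

End iid_average.

(** * Square-integrable functions *)

Section square_integrable.
Context d (T : measurableType d) (R : realType) (mu : probability T R).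
Implicit Types f g : T -> R.

Lemma dominated_cvg0 (u : nat -> T -> R) (G : T -> R) :
  (forall n, measurable_fun setT (u n)) ->
  mu.-integrable setT (EFin \o G) ->
  (forall n x, 0 <= u n x <= G x) ->
  (forall x, u n x @[n --> \oo] --> 0) ->
  \int[mu]_x u n x @[n --> \oo] --> 0.
Proof.
move=> mu_ iG uG u0.
have [||||_ _] := @dominated_convergence _ _ _ mu _ measurableT
  (fun n x => (u n x)%:E) (cst 0%E) (EFin \o G) _ _ _ iG.
- by move=> n; apply/measurable_EFinP.
- exact: measurable_cst.
- by apply: aeW => x _; apply/cvg_EFin; [exact: nearW|exact: u0].
- apply: aeW => x n _ /=; have /andP[? ?] := uG n x.
  by rewrite lee_fin ger0_norm.
by rewrite integral0 => H; exact: fine_cvg H.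
Qed.

Definition sqint f : Prop :=
  measurable_fun setT f /\ mu.-integrable setT (EFin \o (fun x => f x ^+ 2)).

Lemma integrable_EFinD f g :
  mu.-integrable setT (EFin \o f) -> mu.-integrable setT (EFin \o g) ->
  mu.-integrable setT (EFin \o (fun x => f x + g x)).
Proof. by move=> i1 i2; exact: (integrableD measurableT i1 i2). Qed.

Lemma integrable_EFinB f g :
  mu.-integrable setT (EFin \o f) -> mu.-integrable setT (EFin \o g) ->
  mu.-integrable setT (EFin \o (fun x => f x - g x)).
Proof. by move=> i1 i2; exact: (integrableB measurableT i1 i2). Qed.

Lemma integrable_EFinZ (a : R) f :
  mu.-integrable setT (EFin \o f) ->
  mu.-integrable setT (EFin \o (fun x => a * f x)).
Proof. by move=> i1; exact: (integrableZl measurableT a i1). Qed.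

Lemma integrable_le f g : measurable_fun setT f ->
  mu.-integrable setT (EFin \o g) -> (forall x, `|f x| <= g x) ->
  mu.-integrable setT (EFin \o f).
Proof.
move=> mf ig fg; apply: (le_integrable measurableT _ _ ig).
  exact/measurable_EFinP.
by move=> x _ /=; rewrite lee_fin (le_trans (fg x))// ler_norm.
Qed.

Lemma sqint_integrableM f g : sqint f -> sqint g ->
  mu.-integrable setT (EFin \o (fun x => f x * g x)).
Proof.
move=> [mf if2] [mg ig2].
apply: (@integrable_le _ (fun x => f x ^+ 2 + g x ^+ 2)).
- exact: measurable_funM.
- exact: integrable_EFinD.
- move=> x; rewrite normrM -(real_normK (num_real (f x))).
  rewrite -(real_normK (num_real (g x))).
  by move: (normr_ge0 (f x)) (normr_ge0 (g x)) => a b; nra.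
Qed.

Lemma sqint_bounded f (M : R) : measurable_fun setT f ->
  (forall x, `|f x| <= M) -> sqint f.
Proof.
move=> mf fM; split => //; apply: (@bounded_fun_integrable _ _ _ _ _ (M ^+ 2)).
  exact: measurable_funX.
by move=> x; rewrite normrX lerXn2r// nnegrE// (le_trans _ (fM x)).
Qed.

Lemma sqint_integrable f : sqint f -> mu.-integrable setT (EFin \o f).
Proof.
move=> sf; have s1 : sqint (cst 1).
  by apply: (@sqint_bounded _ 1) => // x; rewrite normr1.
have := sqint_integrableM sf s1.
by under [EFin \o _]eq_fun do rewrite /= mulr1.
Qed.

Lemma sqint_le f g : measurable_fun setT f -> sqint g ->
  (forall x, `|f x| <= `|g x|) -> sqint f.
Proof.
move=> mf [mg ig2] fg; split => //; apply: (integrable_le _ ig2).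
  exact: measurable_funX.
move=> x; rewrite normrX -(real_normK (num_real (g x))) lerXn2r// nnegrE//.
Qed.

Lemma sqintD f g : sqint f -> sqint g -> sqint (fun x => f x + g x).
Proof.
move=> sf sg; have [mf if2] := sf; have [mg ig2] := sg; split.
  exact: measurable_funD.
have := integrable_EFinD (integrable_EFinD if2 ig2)
  (integrable_EFinZ 2 (sqint_integrableM sf sg)).
by congr (_.-integrable _ (_ \o _)); apply/funext => x; ring.
Qed.

Lemma sqintZ (a : R) f : sqint f -> sqint (fun x => a * f x).
Proof.
move=> [mf if2]; split; first exact: measurable_funM.
have := integrable_EFinZ (a ^+ 2) if2.
by congr (_.-integrable _ (_ \o _)); apply/funext => x; rewrite exprMn.
Qed.

Lemma sqint_norm f : sqint f -> sqint (fun x => `|f x|).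
Proof.
move=> sf; apply: (sqint_le _ sf) => [|x]; last by rewrite normr_id.
by apply: measurableT_comp => //; case: sf.
Qed.

Lemma Lfun2_sqint f : f \in Lfun mu 2%:E -> sqint f.
Proof.
move=> f2; split; last exact: Lfun2_integrable_sqr.
by move: f2; rewrite inE => /andP[]; rewrite inE.
Qed.

(** Cauchy-Schwarz by the weighted inequality |f| |g| <= a/2 f^2 + g^2 / (2 a), with a = ||g|| + e.
    The extra e > 0 keeps a positive when g vanishes almost everywhere, and is let go to 0. *)
Lemma Rintegral_norm_mul_le f g : sqint f -> sqint g ->
  \int[mu]_x (f x ^+ 2) = 1 ->
  \int[mu]_x (`|f x| * `|g x|) <= Num.sqrt (\int[mu]_x (g x ^+ 2)).
Proof.
move=> sf sg f1; set r := \int[mu]_x (g x ^+ 2).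
have r0 : 0 <= r by apply: Rintegral_ge0 => x _; exact: sqr_ge0.
apply/ler_addgt0Pr => e e0; set a := Num.sqrt r + e.
have a0 : 0 < a by rewrite ltr_wpDl// sqrtr_ge0.
have ra : r / a <= a.
  rewrite ler_pdivrMr// -expr2 -[leLHS]sqr_sqrtr// lerXn2r ?nnegrE ?sqrtr_ge0//.
    by rewrite ltW.
  by rewrite lerDl ltW.
have i1 := sqint_integrableM (sqint_norm sf) (sqint_norm sg).
have [_ if2] := sf; have [_ ig2] := sg.
have h : \int[mu]_x (`|f x| * `|g x|) <=
    \int[mu]_x (a / 2 * f x ^+ 2 + (2 * a)^-1 * g x ^+ 2).
  apply: le_Rintegral => //.
    by apply: integrable_EFinD; exact: integrable_EFinZ.
  move=> x _; rewrite -(real_normK (num_real (f x))) -(real_normK (num_real (g x))).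
  rewrite -subr_ge0.
  rewrite [leRHS](_ : _ = (a * `|f x| - `|g x|) ^+ 2 / (2 * a)).
    by rewrite divr_ge0 ?sqr_ge0// mulr_ge0// ltW.
  by field; rewrite gt_eqF.
apply: (le_trans h); rewrite RintegralD//; try exact: integrable_EFinZ.
rewrite !RintegralZl// f1 mulr1 -/r -/a.
have -> : (2 * a)^-1 * r = r / a / 2 by field; rewrite gt_eqF.
by move: ra; move: (r / a) => b rb; lra.
Qed.

End square_integrable.

(** * Expansion of the averaging operator under a local alternative *)

Section one_step.
Context {R : realType}.

Section pointwise.
Variables (C : R) (f f1 f2 : R -> R).
Hypothesis tf : taylor2 C f f1 f2.

(** Here and in the next two lemmas, the first argument of [Num.min] does not depend on s and
    supplies the integrable majorant, while the second one tends to 0 as s grows and forces the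
    pointwise limit. *)
Lemma taylor2_min0 x y s : 0 < s ->
  `|f (x + y / s) - f x| <= Num.min 1 (C * `|y| / s).
Proof.
case: tf => C0 _ f01 _ _ r0 _ _ _ s0; rewrite le_min; apply/andP; split.
  have := f01 (x + y / s); have := f01 x; rewrite ler_norml; lra.
by rewrite (le_trans (r0 _ _))// normrM normfV (gtr0_norm s0) mulrA.
Qed.

Lemma taylor2_min1 x y s : 0 < s ->
  `|s * (f (x + y / s) - f x) - y * f1 x|
    <= Num.min (2 * C * `|y|) (C * y ^+ 2 / s).
Proof.
case: tf => C0 _ _ b1 _ r0 r1 _ _ s0.
have s0' : s != 0 by rewrite gt_eqF.
have sV : `|s^-1| = s^-1 by rewrite ger0_norm// invr_ge0 ltW.
rewrite le_min; apply/andP; split.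
  rewrite (le_trans (ler_normB _ _))// !normrM (gtr0_norm s0).
  have -> : 2 * C * `|y| = s * (C * `|y / s|) + `|y| * C.
    by rewrite normrM sV; field.
  by rewrite lerD// ler_wpM2l// ltW.
have -> : s * (f (x + y / s) - f x) - y * f1 x =
    s * (f (x + y / s) - f x - f1 x * (y / s)) by field.
rewrite normrM (gtr0_norm s0).
have -> : C * y ^+ 2 / s = s * (C * (y / s) ^+ 2) by field.
by rewrite ler_wpM2l// ltW.
Qed.

Lemma taylor2_min2 x y s : 0 < s ->
  `|s ^+ 2 * (f (x + y / s) - f x) - s * y * f1 x - y ^+ 2 * f2 x / 2|
    <= Num.min (2 * C * y ^+ 2) (C * `|y| ^+ 3 / s).
Proof.
case: tf => C0 _ _ _ b2 r0 r1 r2 _ s0.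
have s0' : s != 0 by rewrite gt_eqF.
have sV : `|s^-1| = s^-1 by rewrite ger0_norm// invr_ge0 ltW.
have s2 : 0 <= s ^+ 2 by exact: sqr_ge0.
rewrite le_min; apply/andP; split.
  rewrite [X in X - _](_ : _ = s ^+ 2 * (f (x + y / s) - f x - f1 x * (y / s)));
    last by field.
  rewrite (le_trans (ler_normB _ _))// normrM (ger0_norm s2) -mulrA.
  rewrite [`|y ^+ 2 * _|]normrM [`|f2 x / 2|]normrM.
  have -> : 2 * C * y ^+ 2 = s ^+ 2 * (C * (y / s) ^+ 2) + C * y ^+ 2 by field.
  rewrite lerD//; first by rewrite ler_wpM2l.
  rewrite (ger0_norm (sqr_ge0 y)) (ger0_norm (_ : 0 <= 2^-1)) ?invr_ge0//.
  have := b2 x; have := sqr_ge0 y; have := normr_ge0 (f2 x).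
  by move: (y ^+ 2) `|_| => a b b0 a0 bC; nra.
have -> : s ^+ 2 * (f (x + y / s) - f x) - s * y * f1 x - y ^+ 2 * f2 x / 2 =
    s ^+ 2 * (f (x + y / s) - f x - f1 x * (y / s) - f2 x * (y / s) ^+ 2 / 2)
  by field.
rewrite normrM (ger0_norm s2).
have -> : C * `|y| ^+ 3 / s = s ^+ 2 * (C * `|y / s| ^+ 3).
  by rewrite normrM sV; field.
by rewrite ler_wpM2l.
Qed.

End pointwise.

Context d (T : measurableType d).

(* [(1 + t / 2 * w) ^+ 2] is the density of the absolutely continuous part of
   [Q], and the singular part of [Q] lives on [N]. *)
Definition sqrt_density (P0 Q : probability T R) (t : R) (w : T -> R) (N : set T)
    : Prop :=
  forall h : T -> R, unitfun h ->
    (\int[Q]_x (h x)%:E = \int[P0]_x (h x * (1 + t / 2 * w x) ^+ 2)%:E +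
                          \int[Q]_(x in N) (h x)%:E)%E.

(** Expand (1 + t/2 w)^2 = 1 + t w + t^2/4 w^2 against the increment D of f. At scale s = sqrt n,
    s^2 times the integral of D gives f''/2 since X is centred with variance 1, (t s) s times that
    of D w gives the drift, and (t s)^2/4 times that of D w^2 is an error. The remaining terms of
    the bound measure t s against l, w against g, and the singular mass. *)
Lemma one_step (P0 Q : probability T R) (X g w : T -> R) (N : set T)
    (t s C l : R) (f f1 f2 : R -> R) (x : R) :
  taylor2 C f f1 f2 -> 0 < s -> sqint P0 X -> sqint P0 g -> sqint P0 w ->
  measurable N -> sqrt_density P0 Q t w N ->
  \int[P0]_y X y = 0 -> \int[P0]_y (X y ^+ 2) = 1 ->
  let u2 := \int[P0]_y Num.min (2 * C * X y ^+ 2) (C * `|X y| ^+ 3 / s) in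
  let u1 := \int[P0]_y (Num.min (2 * C * `|X y|) (C * X y ^+ 2 / s) * `|g y|) in
  let u0 := \int[P0]_y (Num.min 1 (C * `|X y| / s) * g y ^+ 2) in
  let r := \int[P0]_y ((w y - g y) ^+ 2) in
  let k := \int[P0]_y (X y * g y) in
  (`| s ^+ 2 * (avg Q (fun y => X y / s) f x - f x) - (l * k * f1 x + f2 x / 2) |
  <= u2 + `|t * s| * (u1 + 3 * C * Num.sqrt r) + `|t * s - l| * C * `|k|
     + (t * s) ^+ 2 / 2 * (u0 + r) + s ^+ 2 * fine (Q N) : Prop).
Proof.
move=> tf s0 sX sg sw mN dens X0 X1 u2 u1 u0 r k.
case: (tf) => C0 cf f01 b1 b2 _ _ _ _.
have mf : measurable_fun setT f by exact: continuous_measurable_fun.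
have [mX iX2] := sX; have [mg ig2] := sg; have [mw iw2] := sw.
pose F y := f (x + X y / s).
pose D y := F y - f x.
have mXs : measurable_fun setT (fun y => X y / s) by exact: measurable_funM.
have uF : unitfun F by apply: unitfun_shift => //; split.
have mF : measurable_fun setT F by case: uF.
have mD : measurable_fun setT D by exact: measurable_funB.
have D1 y : `|D y| <= 1.
  by have := taylor2_min0 tf x (X y) s0; rewrite le_min => /andP[].
have sD : sqint P0 D by exact: sqint_bounded D1.
have sr : sqint P0 (fun y => w y - g y).
  have := sqintD sw (sqintZ (-1) sg).
  by under [X in sqint _ X -> _]eq_fun do rewrite mulN1r.
have [mr ir2] := sr.
have iD := sqint_integrable sD.
have iDw := sqint_integrableM sD sw.
have sDw : sqint P0 (fun y => D y * w y).
  apply: (sqint_le _ sw) => [|y]; first exact: measurable_funM.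
  by rewrite normrM ler_piMl.
have iDww := sqint_integrableM sDw sw.
pose q y := (1 + t / 2 * w y) ^+ 2.
have iDq : P0.-integrable setT (EFin \o (fun y => D y * q y)).
  have := integrable_EFinD (integrable_EFinD iD (integrable_EFinZ t iDw))
    (integrable_EFinZ (t ^+ 2 / 4) iDww).
  by congr (_.-integrable _ (_ \o _)); apply/funext => y; rewrite /q; field.
have sc1 : sqint P0 (cst 1).
  by apply: (@sqint_bounded _ _ _ _ _ 1) => // y; rewrite normr1.
have s1w : sqint P0 (fun y => 1 + t / 2 * w y).
  by apply: sqintD => //; exact: sqintZ.
have [mq' iq] := s1w.
have iFq : P0.-integrable setT (EFin \o (fun y => F y * q y)).
  apply: (integrable_le _ iq) => [|y].
    by apply: measurable_funM => //; exact: measurable_funX.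
  case: uF => _ /(_ y) /andP[F0 F1].
  by rewrite normrM (ger0_norm F0) (ger0_norm (sqr_ge0 _)) ler_piMl// sqr_ge0.
have u1' : unitfun (cst 1 : T -> R) by split => //= _; rewrite ler01 lexx.
have iFQ : Q.-integrable setT (EFin \o F) by exact: unitfun_integrable.
have iFN : Q.-integrable N (EFin \o F) by apply: integrableS iFQ.
have FN0 : 0 <= \int[Q]_(y in N) F y.
  by apply: Rintegral_ge0 => y _; case: uF => _ /(_ y) /andP[].
have FN1 : \int[Q]_(y in N) F y <= fine (Q N).
  rewrite -[leRHS]mul1r -Rintegral_cst//; apply: le_Rintegral => //.
    by apply: integrableS (unitfun_integrable Q u1').
  by move=> y _; case: uF => _ /(_ y) /andP[].
have splitF : avg Q (fun y => X y / s) f x =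
    \int[P0]_y (F y * q y) + \int[Q]_(y in N) F y.
  rewrite /avg -[\int[Q]_w _]/(fine _) (dens F uF) fineD//.
  - exact: integrable_fin_num iFq.
  - exact: integrable_fin_num iFN.
have iq1 : P0.-integrable setT (EFin \o (fun y => 1 * q y)).
  by under [EFin \o _]eq_fun do rewrite /= mul1r.
(* The density identity tested on the constant 1. Multiplied by f x and subtracted, it turns F into
   the increment D in [avgB]. *)
have split1 : 1 = \int[P0]_y q y + fine (Q N).
  have hT : (\int[Q]_x (cst (1 : R) x)%:E = 1)%E.
    apply: (etrans (integral_cst Q measurableT 1%E)).
    by rewrite mul1e; exact: probability_setT.
  have hN : (\int[Q]_(x in N) (cst (1 : R) x)%:E = Q N)%E.
    by apply: (etrans (integral_cst Q mN 1%E)); rewrite mul1e.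
  have := dens _ u1'; rewrite hT hN => /(congr1 fine).
  rewrite fineD//; last 2 first.
  - exact: integrable_fin_num iq1.
  - exact: fin_num_measure.
  rewrite /= => ->.
  by congr (fine _ + _); apply: eq_integral => y _; rewrite mul1r.
have avgB : avg Q (fun y => X y / s) f x - f x =
    \int[P0]_y D y + t * \int[P0]_y (D y * w y) +
    t ^+ 2 / 4 * \int[P0]_y (D y * w y * w y) +
    (\int[Q]_(y in N) F y - f x * fine (Q N)).
  rewrite splitF -[X in _ - X = _]mulr1 [X in _ - _ * X = _]split1.
  rewrite -RintegralZl// -RintegralZl// -RintegralD//; last exact: integrable_EFinZ.
  rewrite -RintegralD//; last 2 first.
  - by apply: integrable_EFinD => //; exact: integrable_EFinZ.
  - exact: integrable_EFinZ.
  rewrite mulrDr -RintegralZl// opprD addrACA; congr (_ + _).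
  rewrite -RintegralB//; last exact: integrable_EFinZ.
  by apply: eq_Rintegral => y _; rewrite /D /q; field.
have iX := sqint_integrable sX.
have iXg := sqint_integrableM sX sg.
have iaXr := sqint_integrableM (sqint_norm sX) (sqint_norm sr).
have hXr : \int[P0]_y (`|X y| * `|w y - g y|) <= Num.sqrt r.
  exact: Rintegral_norm_mul_le.
have e2 : `|s ^+ 2 * \int[P0]_y D y - f2 x / 2| <= u2.
  have mu2 : measurable_fun setT
      (fun y => Num.min (2 * C * X y ^+ 2) (C * `|X y| ^+ 3 / s)).
    apply: measurable_minr.
      by apply: measurable_funM => //; exact: measurable_funX.
    apply: measurable_funM => //; apply: measurable_funM => //.
    by apply: measurable_funX; exact: measurableT_comp.
  have -> : s ^+ 2 * \int[P0]_y D y - f2 x / 2 = \int[P0]_y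
      (s ^+ 2 * D y - s * f1 x * X y - f2 x / 2 * X y ^+ 2).
    rewrite [RHS]RintegralB//; [|by apply: integrable_EFinB; exact: integrable_EFinZ
      |exact: integrable_EFinZ].
    rewrite [in RHS]RintegralB; [|by []|exact: integrable_EFinZ..].
    by rewrite !RintegralZl// X0 X1 mulr0 subr0 mulr1.
  apply: (le_trans (le_normr_Rintegral _ _)) => //.
    apply: integrable_EFinB; last exact: integrable_EFinZ.
    by apply: integrable_EFinB; exact: integrable_EFinZ.
  have pw y : `|s ^+ 2 * D y - s * f1 x * X y - f2 x / 2 * X y ^+ 2| <=
      Num.min (2 * C * X y ^+ 2) (C * `|X y| ^+ 3 / s).
    have := taylor2_min2 tf x (X y) s0.
    by congr (`| _ - _ - _ | <= _); rewrite /D; field.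
  have iu2 : P0.-integrable setT (EFin \o
      (fun y => Num.min (2 * C * X y ^+ 2) (C * `|X y| ^+ 3 / s))).
    apply: (integrable_le _ (integrable_EFinZ (2 * C) iX2)) => // y.
    rewrite ger0_norm ?ge_min ?lexx//.
    by apply: le_trans (pw y).
  apply: le_Rintegral => //.
  apply: (integrable_le _ iu2) => [|y]; last by rewrite normr_id pw.
  apply: measurableT_comp => //; apply: measurable_funB.
    by apply: measurable_funB; exact: measurable_funM.
  by apply: measurable_funM => //; exact: measurable_funX.
have e1 : `|s * \int[P0]_y (D y * w y) - k * f1 x| <= u1 + 3 * C * Num.sqrt r.
  pose m y := Num.min (2 * C * `|X y|) (C * X y ^+ 2 / s).
  have m0 y : 0 <= m y.
    rewrite /m le_min; apply/andP; split; first by rewrite !mulr_ge0.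
    by apply: divr_ge0; [rewrite mulr_ge0// sqr_ge0|exact: ltW].
  have mm : measurable_fun setT m.
    apply: measurable_minr.
      by apply: measurable_funM => //; exact: measurableT_comp.
    apply: measurable_funM => //; apply: measurable_funM => //.
    exact: measurable_funX.
  have imX : sqint P0 m.
    apply: (sqint_le mm (sqintZ (2 * C) sX)) => y.
    rewrite (ger0_norm (m0 y)) normrM (ger0_norm (_ : 0 <= 2 * C)) ?mulr_ge0//.
    by rewrite /m ge_min lexx.
  have -> : s * \int[P0]_y (D y * w y) - k * f1 x =
      \int[P0]_y (s * (D y * w y) - f1 x * (X y * g y)).
    rewrite [RHS]RintegralB//; [|exact: integrable_EFinZ..].
    by rewrite !RintegralZl// mulrC [f1 x * _]mulrC mulrC.
  have i1 : P0.-integrable setT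
      (EFin \o (fun y => s * (D y * w y) - f1 x * (X y * g y))).
    by apply: integrable_EFinB; exact: integrable_EFinZ.
  apply: (le_trans (le_normr_Rintegral _ _)) => //.
  have img := sqint_integrableM imX (sqint_norm sg).
  have i2 : P0.-integrable setT (EFin \o (fun y => m y * `|g y| +
      3 * C * (`|X y| * `|w y - g y|))).
    by apply: integrable_EFinD => //; exact: integrable_EFinZ.
  have pw y : `|s * (D y * w y) - f1 x * (X y * g y)| <=
      m y * `|g y| + 3 * C * (`|X y| * `|w y - g y|).
    (* Compare w with g: the g part is controlled by the minimum m. For the w - g part, the crude
       bound 2 C |X| on the first-order remainder and the bound C |X| on X f' add up to the factor 3
       C. *)
    have -> : s * (D y * w y) - f1 x * (X y * g y) =
      (s * D y - X y * f1 x) * g y + (s * D y - X y * f1 x) * (w y - g y) +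
      f1 x * (X y * (w y - g y)) by ring.
    have mD1 := taylor2_min1 tf x (X y) s0.
    have mC : m y <= 2 * C * `|X y| by rewrite /m ge_min lexx.
    rewrite -addrA (le_trans (ler_normD _ _))// normrM lerD//.
      by rewrite ler_wpM2r.
    rewrite (le_trans (ler_normD _ _))// !normrM.
    have -> : 3 * C * (`|X y| * `|w y - g y|) =
      2 * C * `|X y| * `|w y - g y| + C * (`|X y| * `|w y - g y|) by ring.
    rewrite lerD//; last by rewrite ler_wpM2r// mulr_ge0.
    by rewrite ler_wpM2r// (le_trans mD1).
  apply: (@le_trans _ _ (\int[P0]_y (m y * `|g y| +
      3 * C * (`|X y| * `|w y - g y|)))); last first.
    rewrite RintegralD//; last exact: integrable_EFinZ.
    by rewrite lerD2l RintegralZl// ler_wpM2l ?mulr_ge0.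
  apply: le_Rintegral => //.
  apply: (integrable_le _ i2) => [|y]; last by rewrite normr_id.
  by apply: measurableT_comp => //; exact/measurable_EFinP/(measurable_int _ i1).
have e0 : `|\int[P0]_y (D y * w y * w y)| <= 2 * (u0 + r).
  pose m y := Num.min 1 (C * `|X y| / s).
  have m0 y : 0 <= m y.
    rewrite /m le_min ler01/=.
    by apply: divr_ge0; [rewrite mulr_ge0|exact: ltW].
  have mm : measurable_fun setT m.
    apply: measurable_minr => //; apply: measurable_funM => //.
    by apply: measurable_funM => //; exact: measurableT_comp.
  have img : P0.-integrable setT (EFin \o (fun y => m y * g y ^+ 2)).
    apply: (integrable_le _ ig2) => [|y].
      by apply: measurable_funM => //; exact: measurable_funX.
    rewrite normrM (ger0_norm (m0 y)) (ger0_norm (sqr_ge0 _)).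
    by rewrite ler_piMl ?sqr_ge0// /m ge_min lexx.
  apply: (le_trans (le_normr_Rintegral _ _)) => //.
  apply: (@le_trans _ _ (\int[P0]_y (2 * (m y * g y ^+ 2 + (w y - g y) ^+ 2))));
    last first.
    rewrite RintegralZl//; last exact: integrable_EFinD.
    by rewrite ler_wpM2l// RintegralD.
  apply: le_Rintegral => //.
  - apply: (integrable_le _ iw2) => [|y].
      apply: measurableT_comp => //.
      by apply: measurable_funM => //; exact: measurable_funM.
    by rewrite normr_id -mulrA -expr2 normrM (ger0_norm (sqr_ge0 _)) ler_piMl// sqr_ge0.
  - by apply: integrable_EFinZ; exact: integrable_EFinD.
  - move=> y _; rewrite -mulrA -expr2 normrM (ger0_norm (sqr_ge0 _)).
    have mD0 : `|D y| <= m y := taylor2_min0 tf x (X y) s0.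
    have m1 : m y <= 1 by rewrite /m ge_min lexx.
    rewrite (le_trans (ler_wpM2r (sqr_ge0 _) mD0))//.
    move: (m y) (m0 y) m1 (w y) (g y) => c c0 c1 a b.
    rewrite -subr_ge0.
    (* With a = w, b = g and a weight c in [0, 1], the difference is a sum of squares with
       nonnegative coefficients. Only the g^2 term keeps the small weight; (w - g)^2 is small by
       itself. *)
    have -> : 2 * (c * b ^+ 2 + (a - b) ^+ 2) - c * a ^+ 2 =
      c * (a - 2 * b) ^+ 2 + 2 * ((1 - c) * (a - b) ^+ 2) by ring.
    apply: addr_ge0; first by apply: mulr_ge0 => //; exact: sqr_ge0.
    by apply: mulr_ge0 => //; apply: mulr_ge0; rewrite ?sqr_ge0 ?subr_ge0.
pose B := \int[Q]_(y in N) F y - f x * fine (Q N); rewrite -/B in avgB.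
(* B is a difference of two numbers lying between 0 and [fine (Q N)]. *)
have B1 : `|B| <= fine (Q N).
  have /andP[fx0 fx1] := f01 x.
  rewrite ler_norml /B; move: FN0 FN1; move: (\int[Q]_(y in N) F y) (fine (Q N)).
  move=> a b a0 ab; have b0 := le_trans a0 ab.
  have := mulr_ge0 fx0 b0; have : f x * b <= b by rewrite ler_piMl.
  by move: (f x * b) => c cb c0; apply/andP; split; lra.
have -> : s ^+ 2 * (avg Q (fun y => X y / s) f x - f x) -
    (l * k * f1 x + f2 x / 2) =
  (s ^+ 2 * \int[P0]_y D y - f2 x / 2) +
  t * s * (s * \int[P0]_y (D y * w y) - k * f1 x) + (t * s - l) * k * f1 x +
  (t * s) ^+ 2 / 4 * \int[P0]_y (D y * w y * w y) + s ^+ 2 * B.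
  by rewrite avgB; field.
rewrite (le_trans (ler_normD _ _))// lerD//; last first.
  by rewrite normrM (ger0_norm (sqr_ge0 _)) ler_wpM2l// sqr_ge0.
rewrite (le_trans (ler_normD _ _))// lerD//; last first.
  rewrite normrM ger0_norm ?divr_ge0 ?sqr_ge0//.
  rewrite (le_trans (ler_wpM2l _ e0)) ?divr_ge0 ?sqr_ge0//.
  by rewrite le_eqVlt; apply/orP; left; apply/eqP; field.
rewrite (le_trans (ler_normD _ _))// lerD//; last first.
  by rewrite -mulrA normrM -[leRHS]mulrA ler_wpM2l// normrM mulrC ler_wpM2r.
rewrite (le_trans (ler_normD _ _))// lerD// normrM.
by rewrite ler_wpM2l.
Qed.

End one_step.

Section local_expansion.
Context {R : realType}.

Lemma cvg_sqrt_natV : (Num.sqrt n%:R)^-1 @[n --> \oo] --> (0 : R).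
Proof.
have -> : (fun n => (Num.sqrt n%:R)^-1) = (fun n => Num.sqrt (n%:R^-1)) :> (nat -> R).
  by apply/funext => n; rewrite sqrtrV.
rewrite -[X in _ --> X](sqrtr0 R).
apply: (cvg_comp (fun n : nat => n%:R^-1) Num.sqrt); last exact: sqrt_continuous.
apply/gtr0_cvgV0; last exact: cvgr_idn.
by exists 1%N => // n /= n1; rewrite ltr0n.
Qed.

Context d (T : measurableType d).

(** Dominated convergence with majorant A K. The term B K / sqrt n serves only for the pointwise
    limit, so B may contain |X|^3. *)
Lemma cvg_Rintegral_min (P0 : probability T R) (A B K : T -> R) :
  measurable_fun setT A -> measurable_fun setT B -> measurable_fun setT K ->
  (forall y, 0 <= A y) -> (forall y, 0 <= B y) -> (forall y, 0 <= K y) ->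
  P0.-integrable setT (EFin \o (fun y => A y * K y)) ->
  \int[P0]_y (Num.min (A y) (B y / Num.sqrt n%:R) * K y) @[n --> \oo] --> 0.
Proof.
move=> mA mB mK A0 B0 K0 iAK.
have m0 n y : 0 <= Num.min (A y) (B y / Num.sqrt n%:R).
  by rewrite le_min A0 divr_ge0// sqrtr_ge0.
apply: (dominated_cvg0 _ iAK).
- move=> n; apply: measurable_funM => //; apply: measurable_minr => //.
  exact: measurable_funM.
- by move=> n y; rewrite mulr_ge0//= ler_wpM2r// ge_min lexx.
- move=> y; apply: (@squeeze_cvgr _ _ _ _ (cst 0)
    (fun n => B y * K y * (Num.sqrt n%:R)^-1)).
  + apply: nearW => n; rewrite mulr_ge0//=.
    by rewrite mulrAC ler_wpM2r// ge_min lexx orbT.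
  + exact: cvg_cst.
  + rewrite -[X in _ --> X](mulr0 (B y * K y)).
    by apply: cvgM; [exact: cvg_cst|exact: cvg_sqrt_natV].
Qed.

Lemma local_expansion (P0 : probability T R) (Q : nat -> probability T R)
    (X g : T -> R) (w : nat -> T -> R) (N : nat -> set T) (t : nat -> R)
    (C l : R) (f f1 f2 : R -> R) :
  taylor2 C f f1 f2 -> sqint P0 X -> sqint P0 g ->
  (forall n, measurable_fun setT (w n)) -> (forall n, measurable (N n)) ->
  (\forall n \near \oo, sqrt_density P0 (Q n) (t n) (w n) (N n)) ->
  \int[P0]_y X y = 0 -> \int[P0]_y (X y ^+ 2) = 1 ->
  t n * Num.sqrt n%:R @[n --> \oo] --> l ->
  (\int[P0]_y ((w n y - g y) ^+ 2)%:E @[n --> \oo] --> 0)%E ->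
  n%:R * fine (Q n (N n)) @[n --> \oo] --> 0 ->
  exists2 e : nat -> R, e n @[n --> \oo] --> 0 &
    \forall n \near \oo, forall x,
    `| n%:R * (avg (Q n) (fun y => X y / Num.sqrt n%:R) f x - f x) -
       (l * \int[P0]_y (X y * g y) * f1 x + f2 x / 2) | <= e n.
Proof.
move=> tf sX sg mw mN dens X0 X1 tl wg QN.
have C0 : 0 <= C by case: tf.
have [mX iX2] := sX; have [mg ig2] := sg.
set k := \int[P0]_y (X y * g y).
pose s n : R := Num.sqrt n%:R.
pose u2 n := \int[P0]_y Num.min (2 * C * X y ^+ 2) (C * `|X y| ^+ 3 / s n).
pose u1 n := \int[P0]_y
  (Num.min (2 * C * `|X y|) (C * X y ^+ 2 / s n) * `|g y|).
pose u0 n := \int[P0]_y (Num.min 1 (C * `|X y| / s n) * g y ^+ 2).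
pose r n := \int[P0]_y ((w n y - g y) ^+ 2).
have r0 : r n @[n --> \oo] --> 0 by exact: fine_cvg wg.
have maX : measurable_fun setT (fun y => `|X y|) by exact: measurableT_comp.
have u20 : u2 n @[n --> \oo] --> 0.
  have -> : u2 = fun n => \int[P0]_y
     (Num.min (2 * C * X y ^+ 2) (C * `|X y| ^+ 3 / s n) * 1).
    by apply/funext => n; apply: eq_Rintegral => y _; rewrite mulr1.
  apply: (@cvg_Rintegral_min P0 _ (fun y => C * `|X y| ^+ 3) (cst 1)) => //=.
  - by apply: measurable_funM => //; exact: measurable_funX.
  - by apply: measurable_funM => //; exact: measurable_funX.
  - by move=> y; rewrite mulr_ge0 ?sqr_ge0// mulr_ge0.
  - by move=> y; rewrite mulr_ge0// exprn_ge0.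
  - under [EFin \o _]eq_fun do rewrite /= mulr1.
    exact: integrable_EFinZ.
have u10 : u1 n @[n --> \oo] --> 0.
  apply: (@cvg_Rintegral_min P0 _ (fun y => C * X y ^+ 2) (fun y => `|g y|)) => //=.
  - exact: measurable_funM.
  - by apply: measurable_funM => //; exact: measurable_funX.
  - exact: measurableT_comp.
  - by move=> y; rewrite !mulr_ge0.
  - by move=> y; rewrite mulr_ge0// sqr_ge0.
  - under [EFin \o _]eq_fun do rewrite /= -mulrA.
    apply: integrable_EFinZ.
    exact: (sqint_integrableM (sqint_norm sX) (sqint_norm sg)).
have u00 : u0 n @[n --> \oo] --> 0.
  apply: (@cvg_Rintegral_min P0 (cst 1) (fun y => C * `|X y|) (fun y => g y ^+ 2)) => //=.
  - exact: measurable_funM.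
  - exact: measurable_funX.
  - by move=> y; rewrite mulr_ge0.
  - by move=> y; rewrite sqr_ge0.
  - by under [EFin \o _]eq_fun do rewrite /= mul1r.
exists (fun n => u2 n + `|t n * s n| * (u1 n + 3 * C * Num.sqrt (r n)) +
  `|t n * s n - l| * C * `|k| + (t n * s n) ^+ 2 / 2 * (u0 n + r n) +
  n%:R * fine (Q n (N n))).
  rewrite [X in _ --> X](_ : _ = 0 + `|l| * (0 + 3 * C * Num.sqrt 0) +
    `|l - l| * C * `|k| + l ^+ 2 / 2 * (0 + 0) + 0); last first.
    by rewrite sqrtr0 subrr normr0 !(mulr0, mul0r, addr0).
  have sr : Num.sqrt (r n) @[n --> \oo] --> Num.sqrt (0 : R).
    by apply: continuous_cvg => //; exact: sqrt_continuous.
  apply: cvgD => //; apply: cvgD; first apply: cvgD; first apply: cvgD => //.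
  - apply: cvgM; first exact: cvg_norm.
    by apply: cvgD => //; apply: cvgM => //; exact: cvg_cst.
  - apply: cvgM; last exact: cvg_cst.
    apply: cvgM; last exact: cvg_cst.
    by apply: cvg_norm; apply: cvgB => //; exact: cvg_cst.
  - apply: cvgM; last exact: cvgD.
    apply: cvgM; last exact: cvg_cst.
    by rewrite expr2; under eq_fun do rewrite expr2; exact: cvgM.
(* Convergence in the extended reals makes the integrals of (w n - g)^2 finite from some rank on;
   this is where square integrability of w n comes from. *)
have /fine_cvgP[rfin _] := wg.
near=> n => x.
have n0 : (0 < n)%N by near: n; exact: nbhs_infty_gt.
have sn0 : 0 < s n by rewrite sqrtr_gt0 ltr0n.
have sw : sqint P0 (w n).
  have sr : sqint P0 (fun y => w n y - g y).
    split; first exact: measurable_funB.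
    apply/integrableP; split.
      by apply/measurable_EFinP/measurable_funX; exact: measurable_funB.
    under eq_integral do rewrite /= ger0_norm ?sqr_ge0//.
    rewrite ltey_eq; apply/orP; left.
    by near: n.
  have := sqintD sr sg.
  by under [X in sqint _ X -> _]eq_fun do rewrite subrK.
have dn : sqrt_density P0 (Q n) (t n) (w n) (N n) by near: n.
have := @one_step _ _ _ P0 (Q n) X g (w n) (N n) (t n) (s n) C l f f1 f2 x
  tf sn0 sX sg sw (mN n) dn X0 X1.
by rewrite /= [s n ^+ 2]sqr_sqrtr.
Unshelve. all: by end_near. Qed.

End local_expansion.

(** * The standard normal distribution *)

Section lebesgue_affine.
Context {R : realType}.
Notation mu := (@lebesgue_measure R).

Definition affine (k m : R) (w : measurableTypeR R) : measurableTypeR R :=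
  k * w + m.

Lemma measurable_affine k m : measurable_fun setT (affine k m).
Proof. by apply: measurable_funD => //; exact: measurable_funM. Qed.

HB.instance Definition _ k m :=
  isMeasurableFun.Build _ _ _ _ (affine k m) (measurable_affine k m).

(** By uniqueness of Lebesgue measure, it is enough to check the scaled push-forward on intervals
    []a, b]]. *)
Lemma lebesgue_measure_affine (k : {nonneg R}) (m : R) (A : set R) :
  0 < k%:num -> measurable A ->
  (k%:num%:E * mu (affine k%:num m @^-1` A) = mu A)%E.
Proof.
move=> k0 mA; have mf := measurable_affine k%:num m.
pose nu := measure_function_pushforward__canonical__measure_function_Measure mu mf.
apply/esym; apply: (@lebesgue_measure_unique R (mscale k nu)) => // _ [[a b]] _ <-.
rewrite /= /mscale /= /pushforward /=.
have -> : affine k%:num m @^-1` `]a, b]%classic =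
    `](a - m) / k%:num, (b - m) / k%:num]%classic.
  by apply/seteqP; split => x /=; rewrite !in_itv/= ltr_pdivrMr// ler_pdivlMr//
    ltrBlDr lerBrDr /affine [_ * k%:num]mulrC.
rewrite !lebesgue_measure_itv/= !lte_fin ltr_pM2r ?invr_gt0// ltrD2r.
case: ifPn => ab; last by rewrite mule0.
by rewrite -!EFinD -EFinM; congr EFin; field; exact: lt0r_neq0.
Qed.

Lemma ge0_integral_affine (k m : R) (F : R -> \bar R) : 0 < k ->
  measurable_fun setT F -> (forall x, 0 <= F x)%E ->
  (\int[mu]_x F x = k%:E * \int[mu]_w F (k * w + m)%R)%E.
Proof.
move=> k0 mF F0.
have k0' : 0 <= k by rewrite ltW.
have mf := measurable_affine k m.
pose nu := measure_function_pushforward__canonical__measure_function_Measure mu mf.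
transitivity (\int[mscale (NngNum k0') nu]_x F x)%E.
  apply: eq_measure_integral => A mA _.
  exact: (esym (@lebesgue_measure_affine (NngNum k0') m A k0 mA)).
by rewrite ge0_integral_mscale// ge0_integral_pushforward.
Qed.

Lemma ge0_integral_opp (F : R -> \bar R) :
  measurable_fun setT F -> (forall x, 0 <= F x)%E ->
  (\int[mu]_x F x = \int[mu]_w F (- w)%R)%E.
Proof.
move=> mF F0.
transitivity (\int[pushforward mu (-%R : _ -> measurableTypeR R)]_x F x)%E.
  by apply: eq_measure_integral => A mA _; exact/esym/lebesgue_measureN.
by rewrite ge0_integral_pushforward.
Qed.

End lebesgue_affine.

Section standard_normal.
Context {R : realType}.
Notation mu := (@lebesgue_measure R).
Notation gauss := (normal_prob (0 : R) 1).
Notation phi := (normal_pdf (0 : R) 1).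

Lemma stdnormal_pdfE x : phi x = normal_peak 1 * expR (- x ^+ 2 / 2).
Proof. by rewrite normal_pdfE// /normal_fun subr0 expr1n. Qed.

Lemma stdnormal_pdfN x : phi (- x) = phi x.
Proof. by rewrite !stdnormal_pdfE sqrrN. Qed.

Lemma ge0_integral_stdnormal (F : R -> \bar R) :
  measurable_fun setT F -> (forall x, 0 <= F x)%E ->
  (\int[gauss]_x F x = \int[mu]_x (F x * (phi x)%:E))%E.
Proof.
move=> mF F0; apply: ge0_integral_density => //.
- exact: measurable_normal_pdf.
- by move=> x; exact: normal_pdf_ge0.
Qed.

Lemma ge0_integral_stdnormalN (F : R -> \bar R) :
  measurable_fun setT F -> (forall x, 0 <= F x)%E ->
  (\int[gauss]_x F (- x)%R = \int[gauss]_x F x)%E.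
Proof.
move=> mF F0; rewrite !ge0_integral_stdnormal//; last exact: measurableT_comp.
rewrite [RHS]ge0_integral_opp.
- by apply: eq_integral => x _; rewrite stdnormal_pdfN.
- apply: emeasurable_funM => //; apply/measurable_EFinP.
  exact: measurable_normal_pdf.
- by move=> x; rewrite mule_ge0// lee_fin normal_pdf_ge0.
Qed.

Lemma is_derive_stdnormal_pdf (x : R) : is_derive x 1 phi (- x * phi x).
Proof.
have -> : phi = (fun x => normal_peak 1 * expR (- (x * x) / 2)).
  by apply/funext => y; rewrite stdnormal_pdfE expr2.
have dm : is_derive x 1 (fun h : R => h * h) (x *: (1:R) + x *: (1:R)).
  exact: is_deriveM.
have d1 : is_derive x 1 (fun h : R => - (h * h) / 2) (- x).
  apply: is_derive_eq.
  by rewrite /GRing.scale/=; field.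
have d2 : is_derive x 1 (expR \o (fun h : R => - (h * h) / 2))
    (expR (- (x * x) / 2) * - x).
  exact: is_derive1_comp.
have -> : (fun x => normal_peak 1 * expR (- (x * x) / 2)) =
  (normal_peak 1 \*: (expR \o (fun h : R => - (h * h) / 2)) : R -> R) by [].
apply: is_derive_eq.
by rewrite /GRing.scale/=; ring.
Qed.

Lemma continuous_stdnormal_pdf : continuous phi.
Proof. exact: continuous_normal_pdf. Qed.

(** From [expR (x^2/2) >= 1 + x^2/2], the product is at most a constant over x. It is the boundary
    term at infinity in the computation of the second moment. *)
Lemma cvg_mul_stdnormal_pdf : x * phi x @[x --> +oo] --> (0 : R).
Proof.
apply: (@squeeze_cvgr _ _ _ _ (cst 0) (fun x => (normal_peak 1 * 2) * x^-1)).
- near=> x.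
  have x0 : 0 < x by near: x; exact: nbhs_pinfty_gt.
  have x2 : 0 < x ^+ 2 by rewrite exprn_gt0.
  have p0 : 0 < normal_peak (1 : R) by exact: normal_peak_gt0.
  rewrite stdnormal_pdfE; apply/andP; split.
    by apply: mulr_ge0; [exact: ltW|rewrite mulr_ge0 ?expR_ge0// ltW].
  rewrite mulrCA -[leRHS]mulrA ler_pM2l// mulNr expRN.
  rewrite ler_pdivrMr ?expR_gt0// mulrC mulrA ler_pdivlMr//.
  have := expR_ge1Dx (x ^+ 2 / 2); rewrite -expr2; lra.
- exact: cvg_cst.
- rewrite -[X in _ --> X](mulr0 (normal_peak 1 * 2)).
  apply: cvgM; first exact: cvg_cst.
  apply/gtr0_cvgV0; last exact: cvg_id.
  exact: nbhs_pinfty_gt.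
Unshelve. all: by end_near. Qed.

(* [x ^+ 2 - 1] has the antiderivative [- x] with respect to the density, and it
   has constant sign on each of [[0, 1]] and [[1, +oo[]. *)
Lemma stdnormal_second_moment : (\int[gauss]_x (x ^+ 2)%:E = 1)%E.
Proof.
have dF (x : R) : is_derive x 1 (fun h : R => h * phi h) ((1 - x ^+ 2) * phi x).
  have d0 := is_derive_stdnormal_pdf x.
  have dm : is_derive x 1 (fun h : R => h * phi h)
    (x *: (- x * phi x) + phi x *: (1:R)) by exact: is_deriveM.
  by apply: is_derive_eq; rewrite /GRing.scale/=; ring.
have dG (x : R) : is_derive x 1 (fun h : R => - (h * phi h))
    ((x ^+ 2 - 1) * phi x).
  by have d0 := dF x; apply: is_derive_eq; ring.
have cF : continuous (fun h : R => h * phi h).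
  move=> x; apply: differentiable_continuous; apply/derivable1_diffP.
  by have [] := dF x.
have csq : continuous (fun x : R => x ^+ 2) by exact: exprn_continuous.
have cf : continuous (fun x : R => (1 - x ^+ 2) * phi x).
  move=> x; apply: cvgM; last exact: continuous_stdnormal_pdf.
  by apply: cvgB; [exact: cvg_cst|exact: csq].
have cg : continuous (fun x : R => (x ^+ 2 - 1) * phi x).
  move=> x; apply: cvgM; last exact: continuous_stdnormal_pdf.
  by apply: cvgB; [exact: csq|exact: cvg_cst].
have ch : continuous (fun x : R => x ^+ 2 * phi x).
  by move=> x; apply: cvgM; [exact: csq|exact: continuous_stdnormal_pdf].
have phi0 x : 0 <= phi x := normal_pdf_ge0 0 1 x.
have mphi : measurable_fun setT (EFin \o phi).
  by apply/measurable_EFinP; exact: measurable_normal_pdf.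
have mh : measurable_fun setT (fun x : R => (x ^+ 2 * phi x)%:E).
  by apply/measurable_EFinP; exact: continuous_measurable_fun.
have e1 : (\int[mu]_(x in `[0%R, 1%R]) (phi x)%:E =
    \int[mu]_(x in `[0%R, 1%R]) (x ^+ 2 * phi x)%:E + (phi 1)%:E)%E.
  have <- : (\int[mu]_(x in `[0%R, 1%R]) ((1 - x ^+ 2) * phi x)%:E = (phi 1)%:E)%E.
    rewrite (@continuous_FTC2 _ _ (fun h : R => h * phi h) 0 1)//.
    - by rewrite mul0r mul1r sube0.
    - exact: continuous_subspaceT.
    - split; first by move=> x _; have [] := dF x.
        exact/cvg_at_right_filter/cF.
      exact/cvg_at_left_filter/cF.
    - by move=> x _; rewrite derive1E; have [_ ->] := dF x.
  rewrite -ge0_integralD//=.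
  - by apply: eq_integral => x _; rewrite -EFinD; congr EFin; ring.
  - by move=> x _; rewrite lee_fin mulr_ge0// sqr_ge0.
  - exact: measurable_funTS.
  - move=> x; rewrite in_itv/= => /andP[x0 x1]; rewrite lee_fin mulr_ge0//.
    by rewrite subr_ge0 expr_le1.
  - by apply: measurable_funTS; apply/measurable_EFinP; exact: continuous_measurable_fun.
have e2 : (\int[mu]_(x in `[1%R, +oo[) (x ^+ 2 * phi x)%:E =
    \int[mu]_(x in `[1%R, +oo[) (phi x)%:E + (phi 1)%:E)%E.
  have <- : (\int[mu]_(x in `[1%R, +oo[) ((x ^+ 2 - 1) * phi x)%:E = (phi 1)%:E)%E.
    rewrite (@ge0_continuous_FTC2y _ _ (fun h : R => - (h * phi h)) 1 0)//.
    - by rewrite mul1r -EFinB sub0r opprK.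
    - by move=> x x1; rewrite mulr_ge0// subr_ge0 expr_ge1// (le_trans ler01).
    - exact: continuous_subspaceT.
    - by rewrite -[X in _ --> X]oppr0; apply: cvgN; exact: cvg_mul_stdnormal_pdf.
    - by apply: cvg_at_right_filter; apply: cvgN; exact: cF.
    - by move=> x _; rewrite derive1E; have [_ ->] := dG x.
  rewrite -ge0_integralD//=.
  - by apply: eq_integral => x _; rewrite -EFinD; congr EFin; ring.
  - by move=> x _; rewrite lee_fin.
  - exact: measurable_funTS.
  - move=> x; rewrite in_itv/= andbT => x1; rewrite lee_fin mulr_ge0//.
    by rewrite subr_ge0 expr_ge1// (le_trans ler01).
  - by apply: measurable_funTS; apply/measurable_EFinP; exact: continuous_measurable_fun.
have split0 (F : R -> R) : continuous F -> (forall x, 0 <= F x) ->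
    (\int[mu]_(x in [set x | (0 <= x)%R]) (F x)%:E =
     \int[mu]_(x in `[0%R, 1%R]) (F x)%:E + \int[mu]_(x in `[1%R, +oo[) (F x)%:E)%E.
  move=> cF0 F0; have mF0 : measurable_fun setT (EFin \o F).
    by apply/measurable_EFinP; exact: continuous_measurable_fun.
  rewrite -integral_itv_bndo_bndc; last exact: measurable_funTS.
  rewrite -ge0_integral_setU//=; last 3 first.
  - exact: measurable_funTS.
  - by move=> x _; rewrite lee_fin.
  - apply/disj_setPS => x [/=]; rewrite !in_itv/= => /andP[_ x1] /andP[].
    by rewrite leNgt x1.
  congr integral; apply/seteqP; split => x /=; rewrite !in_itv/= andbT.
    by move=> x0; have [x1|x1] := leP 1 x; [right|left; rewrite x0].
  by move=> [/andP[]//|]; apply: le_trans.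
rewrite ge0_integral_stdnormal//=; last 2 first.
- by apply/measurable_EFinP; exact: continuous_measurable_fun.
- by move=> x; rewrite lee_fin sqr_ge0.
under eq_integral do rewrite -EFinM.
have h0 x : 0 <= x ^+ 2 * phi x by rewrite mulr_ge0// sqr_ge0.
rewrite ge0_symfun_integralT//; last by move=> x /=; rewrite sqrrN stdnormal_pdfN.
(* The term [phi 1] gained on the half-line from 1 is exactly the one missing on the unit interval,
   so x^2 phi and phi have the same integral over the half-line. *)
rewrite split0// e2 addeCA -e1 addeC -split0//; last exact: continuous_stdnormal_pdf.
rewrite -ge0_symfun_integralT//; first exact: integral_normal_pdf.
- exact: continuous_stdnormal_pdf.
- by move=> x /=; rewrite stdnormal_pdfN.
Qed.

Lemma sqint_stdnormal_id : sqint (gauss : probability _ R) id.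
Proof.
split => //; apply/integrableP; split.
  by apply/measurable_EFinP; exact: measurable_funX.
under eq_integral do rewrite /= ger0_norm ?sqr_ge0//.
by rewrite stdnormal_second_moment ltry.
Qed.

(** Reflection exchanges the positive and negative parts, so their integrals agree. In the infinite
    cases of the split, [fine] returns 0 by convention. *)
Lemma stdnormal_mean : \int[gauss]_x x = 0.
Proof.
rewrite /Rintegral integralE.
have -> : (\int[gauss]_x (EFin^\- : R -> \bar R) x =
    \int[gauss]_x (EFin^\+ : R -> \bar R) x)%E.
  rewrite -ge0_integral_stdnormalN//.
    by apply: eq_integral => x _; rewrite funenegE funeposE EFinN oppeK.
  by apply: measurable_funeneg; exact/measurable_EFinP.
by case: integral => [r||] //=; rewrite subrr.
Qed.

(** Put z = (r w - a y) / b, that is, r w = a y + b z. The left side is the joint density of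
    independent standard normals y and z in the coordinates (y, w), with Jacobian r / b. The right
    side factors it into the density of w and the conditional density of y given w, which is normal
    with mean a w / r and standard deviation b / r. *)
Lemma stdnormal_pdf_rotation (a b r w y : R) : 0 < b -> 0 < r ->
  r ^+ 2 = a ^+ 2 + b ^+ 2 ->
  phi (r / b * w - a * y / b) * phi y * (r / b) =
  phi w * normal_pdf (a * w / r) (b / r) y.
Proof.
move=> b0 r0 rE.
have b0' : b != 0 by rewrite gt_eqF.
have r0' : r != 0 by rewrite gt_eqF.
have br0 : b / r != 0 by rewrite mulf_neq0// invr_eq0.
have peakE : normal_peak (b / r) = normal_peak 1 * (r / b).
  rewrite /normal_peak expr1n mul1r -mulrnAr sqrtrM ?sqr_ge0//.
  by rewrite sqrtr_sqr ger0_norm ?divr_ge0 ?ltW// invfM invf_div mulrC.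
rewrite !stdnormal_pdfE normal_pdfE// peakE /normal_fun.
rewrite [LHS](_ : _ = normal_peak 1 * normal_peak 1 * (r / b) *
  (expR (- (r / b * w - a * y / b) ^+ 2 / 2) * expR (- y ^+ 2 / 2))); last by ring.
rewrite [RHS](_ : _ = normal_peak 1 * normal_peak 1 * (r / b) *
  (expR (- w ^+ 2 / 2) * expR (- (y - a * w / r) ^+ 2 / ((b / r) ^+ 2 *+ 2))));
  last by ring.
rewrite -!expRD; congr (_ * expR _).
have aE : a ^+ 2 = r ^+ 2 - b ^+ 2 by rewrite rE addrK.
rewrite -mulr_natr.
rewrite [LHS](_ : _ = - (r ^+ 2 * w ^+ 2 - 2 * r * w * a * y + a ^+ 2 * y ^+ 2 +
  b ^+ 2 * y ^+ 2) / (2 * b ^+ 2)); last by field.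
rewrite [RHS](_ : _ = - (b ^+ 2 * w ^+ 2 + r ^+ 2 * y ^+ 2 - 2 * r * w * a * y +
  a ^+ 2 * w ^+ 2) / (2 * b ^+ 2)); last by field; rewrite b0' r0'.
by congr (- _ / _); rewrite aE; ring.
Qed.

(** Substitute w for z in the inner integral, exchange the integrals, and integrate out y: by
    [stdnormal_pdf_rotation] it enters only through a conditional density, whose integral is 1. *)
Lemma stdnormal_conv (a b : R) (G : R -> \bar R) : 0 < b ->
  measurable_fun setT G -> (forall x, 0 <= G x)%E ->
  (\int[gauss]_y \int[gauss]_z G (a * y + b * z)%R =
   \int[gauss]_w G (Num.sqrt (a ^+ 2 + b ^+ 2) * w)%R)%E.
Proof.
move=> b0 mG G0; set r := Num.sqrt _.
have ab0 : 0 < a ^+ 2 + b ^+ 2 by rewrite ltr_wpDl ?sqr_ge0// exprn_gt0.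
have r0 : 0 < r by rewrite sqrtr_gt0.
have rE : r ^+ 2 = a ^+ 2 + b ^+ 2 by rewrite sqr_sqrtr// ltW.
have b0' : b != 0 by rewrite gt_eqF.
have k0 : 0 < r / b by rewrite divr_gt0.
have mphi : measurable_fun setT phi by exact: measurable_normal_pdf.
have phi0 x : 0 <= phi x := normal_pdf_ge0 0 1 x.
have maff (u v : R) : measurable_fun setT (fun z : R => u * z + v).
  by apply: measurable_funD => //; exact: measurable_funM.
pose I (p : measurableTypeR R * measurableTypeR R) : \bar R :=
  (G (r * p.2)%R *
    (phi (r / b * p.2 - a * p.1 / b) * phi p.1 * (r / b))%:E)%E.
have I0 p : (0 <= I p)%E.
  rewrite mule_ge0// lee_fin; apply: mulr_ge0; first exact: mulr_ge0.
  exact: ltW.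
have mI : measurable_fun setT I.
  apply: emeasurable_funM.
    apply: (measurableT_comp (f := G)
      (g := fun p : measurableTypeR R * measurableTypeR R => r * p.2)) => //.
    exact: measurable_funM.
  apply/measurable_EFinP; apply: measurable_funM => //; apply: measurable_funM.
    apply: measurableT_comp => //; apply: measurable_funB.
      exact: measurable_funM.
    by apply: measurable_funM => //; exact: measurable_funM.
  exact: measurableT_comp.
pose J (p : measurableTypeR R * measurableTypeR R) : \bar R := G (a * p.1 + b * p.2)%R.
have mJ : measurable_fun setT J.
  apply: (measurableT_comp (f := G)
    (g := fun p : measurableTypeR R * measurableTypeR R => a * p.1 + b * p.2)) => //.
  by apply: measurable_funD; exact: measurable_funM.
rewrite ge0_integral_stdnormal; last 2 first.
- exact: (@measurable_fun_fubini_tonelli_F _ _ _ _ _ gauss J mJ (fun p => G0 _)).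
- by move=> y; apply: integral_ge0.
transitivity (\int[mu]_y \int[mu]_w I (y, w))%E.
  apply: eq_integral => y _.
  rewrite ge0_integral_stdnormal//; last first.
    by apply: measurableT_comp => //; under eq_fun do rewrite addrC; exact: maff.
  have mH : measurable_fun setT (fun z => (G (a * y + b * z)%R * (phi z)%:E)%E).
    apply: emeasurable_funM; last exact/measurable_EFinP.
    by apply: measurableT_comp => //; under eq_fun do rewrite addrC; exact: maff.
  rewrite (@ge0_integral_affine _ (r / b) (- (a * y / b)))//; last first.
    by move=> z; rewrite mule_ge0// lee_fin.
  have mH' : measurable_fun setT (fun w : R =>
      (G (a * y + b * (r / b * w - a * y / b))%R *
        (phi (r / b * w - a * y / b))%:E)%E).
    by apply: (measurableT_comp mH); exact: maff.
  rewrite muleAC -EFinM.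
  rewrite -ge0_integralZl//; last 2 first.
  - by move=> w _; rewrite mule_ge0// lee_fin.
  - by rewrite lee_fin; apply: mulr_ge0 => //; exact: ltW.
  apply: eq_integral => w _; rewrite /I /= muleCA -EFinM; congr (G _ * _%:E)%E.
    by field.
  by ring.
rewrite (@fubini_tonelli _ _ _ _ _ mu mu I mI I0).
rewrite ge0_integral_stdnormal//; last first.
  by apply: measurableT_comp => //; exact: measurable_funM.
apply: eq_integral => w _.
have br0 : b / r != 0 by rewrite gt_eqF// divr_gt0.
transitivity (\int[mu]_y (G (r * w)%R * (phi w)%:E *
    (normal_pdf (a * w / r) (b / r) y)%:E))%E.
  apply: eq_integral => y _; rewrite /I /= -muleA -EFinM.
  by rewrite (stdnormal_pdf_rotation _ _ b0 r0 rE).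
rewrite ge0_integralZl//; last 3 first.
- by apply/measurable_EFinP; exact: measurable_normal_pdf.
- by move=> y _; rewrite lee_fin normal_pdf_ge0.
- by rewrite mule_ge0// lee_fin.
by rewrite integral_normal_pdf mule1.
Qed.

End standard_normal.

(** * The normal distribution function, passage from smooth functions to indicators, and normal
    iterates *)

Section normal_cdf.
Context {R : realType}.
Notation mu := (@lebesgue_measure R).
Notation gauss := (normal_prob (0 : R) 1).
Notation phi := (normal_pdf (0 : R) 1).

Lemma integral_indic_comp d (T : measurableType d) (P : probability T R)
    (S : T -> R) (A : set R) : measurable_fun setT S -> measurable A ->
  (\int[P]_x (\1_A (S x))%:E = P (S @^-1` A))%E.
Proof.
move=> mS mA; have mSA : measurable (S @^-1` A).
  by rewrite -[X in measurable X]setTI; exact: mS.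
transitivity (\int[P]_x (\1_(S @^-1` A) x)%:E)%E; first by [].
by rewrite integral_indic// setIT.
Qed.

Lemma stdnormal_gt (c : R) : gauss `]c, +oo[ = gauss `]-oo, - c].
Proof.
have mA : measurable (`]c, +oo[%classic : set R) by [].
have mind : measurable_fun setT (fun x : R => (\1_(`]c, +oo[%classic : set R) x : R)%:E).
  by apply/measurable_EFinP; exact: measurable_indic.
transitivity (\int[gauss]_x (\1_(`]c, +oo[%classic : set R) x : R)%:E)%E.
  by rewrite integral_indic// setIT.
rewrite -ge0_integral_stdnormalN//.
rewrite (integral_indic_comp gauss (S := -%R))//.
have -> : -%R @^-1` `]c, +oo[ = (`]-oo, - c[%classic : set R).
  by apply/seteqP; split => x /=; rewrite !in_itv/= andbT ltrNr.
apply: integral_itv_bndo_bndc; apply: measurable_funTS.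
by apply/measurable_EFinP; exact: measurable_normal_pdf.
Qed.

Lemma PhiN (c : R) : Phi (- c) = fine (gauss `]c, +oo[).
Proof. by rewrite /Phi stdnormal_gt. Qed.

Lemma Phi_add_PhiN (c : R) : Phi c + Phi (- c) = 1.
Proof.
rewrite PhiN /Phi -fineD ?fin_num_measure//.
rewrite -measureU//; last first.
  apply/seteqP; split => x //= []; rewrite !in_itv/= andbT leNgt.
  by move=> /negP.
rewrite (_ : _ `|` _ = setT); last first.
  apply/seteqP; split => x //= _; rewrite !in_itv/= andbT.
  by have [xc|xc] := leP x c; [left|right].
exact: (congr1 fine (probability_setT gauss)).
Qed.

Lemma Phi_le : {homo @Phi R : a b / a <= b}.
Proof.
move=> a b ab; rewrite fine_le ?fin_num_measure//.
apply: le_measure; rewrite ?inE//=; apply: subset_itvl.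
by rewrite bnd_simp.
Qed.

(** The density never exceeds its peak. This quantifies how little mass the limit law puts on the
    window where a logistic function and an indicator differ. *)
Lemma Phi_lipschitz (a b : R) : a <= b ->
  Phi b - Phi a <= normal_peak 1 * (b - a).
Proof.
move=> ab; rewrite -fineB ?fin_num_measure//.
have -> : (gauss `]-oo, b] - gauss `]-oo, a] = gauss `]a, b])%E.
  rewrite (_ : `]-oo, b]%classic = `]-oo, a]%classic `|` `]a, b]%classic :> set R).
    rewrite measureU//; last first.
      apply/seteqP; split => x //= []; rewrite !in_itv/= leNgt => /negP xa.
      by case/andP.
    by rewrite addeAC subee ?add0e// fin_num_measure.
  by rewrite -itv_bndbnd_setU ?bnd_simp.
have mphi : measurable_fun (`]a, b]%classic : set R) (EFin \o phi).
  by apply: measurable_funTS; apply/measurable_EFinP; exact: measurable_normal_pdf.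
rewrite -lee_fin fineK ?fin_num_measure//.
apply: (@le_trans _ _ (\int[mu]_(x in `]a, b]) (normal_peak 1)%:E)%E).
  apply: ge0_le_integral => //=.
  - by move=> x _; rewrite lee_fin normal_pdf_ge0.
  - by move=> x _; rewrite lee_fin normal_pdf_ub// oner_neq0.
rewrite integral_cst//= lebesgue_measure_itv/= lte_fin.
case: ifPn => [_|]; first by rewrite -EFinD -EFinM.
by rewrite -leNgt => ba; rewrite mule0 lee_fin mulr_ge0 ?normal_peak_ge0 ?subr_ge0.
Qed.

Lemma Rintegral_stdnormal_gt (c k : R) :
  \int[gauss]_y \1_(`]c, +oo[%classic : set R) (y + k) = Phi (k - c).
Proof.
rewrite -opprB PhiN /Rintegral (integral_indic_comp gauss (S := fun y => y + k))//.
- congr (fine (gauss _)); apply/seteqP; split => x /=; rewrite !in_itv/= !andbT;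
  by rewrite ltrBlDr.
- exact: measurable_funD.
Qed.

Lemma unitfun_indic (A : set R) : measurable A -> unitfun (\1_A : R -> R).
Proof.
move=> mA; split; first exact: measurable_indic.
by move=> x; rewrite indicE; case: (_ \in _); rewrite /= ?ler01 ?lexx.
Qed.

Lemma unitfun_comp d (T : measurableType d) (S : T -> R) (f : R -> R) :
  measurable_fun setT S -> unitfun f -> unitfun (fun x => f (S x)).
Proof. by move=> mS [mf f01]; split => //; exact: measurableT_comp. Qed.

Lemma taylor2_unitfun C (f f1 f2 : R -> R) : taylor2 C f f1 f2 -> unitfun f.
Proof. by case=> _ cf f01 _ _ _ _ _ _; split => //; exact: continuous_measurable_fun. Qed.

Lemma le_Rintegral_unitfunD d (T : measurableType d) (P : probability T R)
    (f g : T -> R) (e : R) : unitfun f -> unitfun g ->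
  (forall x, f x <= g x + e) -> \int[P]_x f x <= \int[P]_x g x + e.
Proof.
move=> uf ug fg; rewrite -[X in _ + X](Rintegral_probability_cst P e).
have ie : P.-integrable setT (EFin \o (cst e : T -> R)).
  exact: (@bounded_fun_integrable _ _ _ _ _ `|e|).
have ig := unitfun_integrable P ug.
rewrite -RintegralD//; apply: le_Rintegral => //; first exact: unitfun_integrable.
exact: (integrable_EFinD ig ie).
Qed.

(** Outside a window of half-width M / K around c, the argument of the logistic function has modulus
    at least M, so [logistic_le] bounds its distance to the indicator by [M^-1]. *)
Lemma logistic_sandwich (K M c x : R) : 0 < K -> 0 < M ->
  let f := fun x => logistic (K * x + - (K * c)) in
  (\1_(`]c + M / K, +oo[%classic : set R) x <= f x + M^-1 : Prop) /\
  (f x <= \1_(`]c - M / K, +oo[%classic : set R) x + M^-1 : Prop).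
Proof.
move=> K0 M0 f; have lM := logistic_le M0.
have MV : 0 <= M^-1 by rewrite invr_ge0 ltW.
have l0 y := ltW (@logistic_gt0 R y); have l1 y := ltW (@logistic_lt1 R y).
rewrite /f !indicE; split.
  case: (boolP (x \in _)); last by rewrite addr_ge0.
  rewrite inE/= in_itv/= andbT => cx.
  suff : logistic M <= logistic (K * x + - (K * c)) by rewrite /=; lra.
  apply: logistic_homo; rewrite -mulrBr mulrC -ler_pdivrMr// lerBrDl.
  exact: ltW.
case: (boolP (x \in _)) => [_|]; first by rewrite (le_trans (l1 _))// lerDl.
rewrite add0r notin_setE/= in_itv/= andbT => /negP; rewrite -leNgt => cx.
apply: le_trans lM; rewrite -logisticN; apply: logistic_homo.
rewrite -mulrBr mulrC -ler_pdivlMr// mulNr lerBlDl.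
exact: cx.
Qed.

(** Error count for [portmanteau_gt]: one m for replacing the indicator by a logistic function, one
    for convergence, one for returning to a normal probability, and two for shifting the argument of
    [Phi]. *)
Let sandwich_dist (a p q r gq gr u v m : R) :
  p <= q + m -> r <= p + m -> gq <= u + m -> v <= gr + m ->
  `|gq - q| <= m -> `|gr - r| <= m -> u <= a + 2 * m -> a <= v + 2 * m ->
  `|a - p| <= 5 * m.
Proof.
move=> ? ? ? ?; rewrite !ler_norml => /andP[? ?] /andP[? ?] ? ?.
by apply/andP; split; lra.
Qed.

(** Logistic functions centred at c - M / K and c + M / K squeeze the indicator from above and
    below, up to [M^-1]. The underlying space varies with n because samples of size n live on
    n-tuples. *)
Lemma portmanteau_gt (d_ : nat -> measure_display)
    (T_ : forall n, measurableType (d_ n))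
    (P : forall n, probability (T_ n) R) (S : forall n, T_ n -> R) (k : R) :
  (forall n, measurable_fun setT (S n)) ->
  (forall C f f1 f2, taylor2 C f f1 f2 ->
    \int[P n]_x f (S n x) @[n --> \oo] --> \int[gauss]_y f (y + k)) ->
  forall c, \int[P n]_x \1_(`]c, +oo[%classic : set R) (S n x) @[n --> \oo]
    --> Phi (k - c).
Proof.
move=> mS Pf c; apply/cvgrPdist_le => e e0.
(* M makes five errors [M^-1] add up to e; K makes [Phi] vary by at most [M^-1] over a length M / K,
   and is at least 1 as [taylor2_affine] requires. *)
pose M := 5 / e; pose K := Num.max 1 (M * normal_peak 1 * M).
have M0 : 0 < M by rewrite divr_gt0.
have K1 : 1 <= K by rewrite le_max lexx.
have K0 : 0 < K by rewrite (lt_le_trans ltr01).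
have eM : M^-1 = e / 5 by rewrite invf_div.
have pK : normal_peak 1 * (M / K) <= M^-1.
  rewrite mulrA ler_pdivrMr// ler_pdivlMl//.
  by rewrite /K le_max; apply/orP; right; rewrite mulrA.
pose f u := fun x => logistic (K * x + - (K * u)).
have tf u : taylor2 (3 * K ^+ 3) (f u) _ _ :=
  taylor2_affine (- (K * u)) K1 taylor2_logistic.
have uf u := taylor2_unitfun (tf u).
have mI u : measurable (`]u, +oo[%classic : set R) by [].
have uI u := unitfun_indic (mI u).
have mk : measurable_fun setT (fun y : R => y + k) by exact: measurable_funD.
have up u n : \int[P n]_x \1_(`]u + M / K, +oo[%classic : set R) (S n x) <=
    \int[P n]_x f u (S n x) + M^-1.
  apply: le_Rintegral_unitfunD; [exact: unitfun_comp..|move=> x].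
  by have [] := logistic_sandwich u (S n x) K0 M0.
have dn u n : \int[P n]_x f u (S n x) <=
    \int[P n]_x \1_(`]u - M / K, +oo[%classic : set R) (S n x) + M^-1.
  apply: le_Rintegral_unitfunD; [exact: unitfun_comp..|move=> x].
  by have [] := logistic_sandwich u (S n x) K0 M0.
have gup u : Phi (k - (u + M / K)) <= \int[gauss]_y f u (y + k) + M^-1.
  rewrite -Rintegral_stdnormal_gt.
  apply: le_Rintegral_unitfunD; [exact: unitfun_comp..|move=> x].
  by have [] := logistic_sandwich u (x + k) K0 M0.
have gdn u : \int[gauss]_y f u (y + k) <= Phi (k - (u - M / K)) + M^-1.
  rewrite -Rintegral_stdnormal_gt.
  apply: le_Rintegral_unitfunD; [exact: unitfun_comp..|move=> x].
  by have [] := logistic_sandwich u (x + k) K0 M0.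
have MK0 : 0 <= M / K by rewrite divr_ge0// ltW.
have lip v w : v <= w -> w <= v + 2 * (M / K) -> Phi w <= Phi v + 2 * M^-1.
  move=> vw wv; rewrite -lerBlDl (le_trans (Phi_lipschitz vw))//.
  apply: le_trans (_ : normal_peak 1 * (2 * (M / K)) <= _).
    by rewrite ler_wpM2l ?normal_peak_ge0//; lra.
  by rewrite mulrCA ler_pM2l.
have eM0 : 0 < M^-1 by rewrite invr_gt0.
have cu := Pf _ _ _ _ (tf (c - M / K)).
have cd := Pf _ _ _ _ (tf (c + M / K)).
near=> n.
have h1 : `|\int[gauss]_y f (c - M / K) (y + k) -
    \int[P n]_x f (c - M / K) (S n x)| <= M^-1.
  by near: n; move/cvgrPdist_le : cu; exact.
have h2 : `|\int[gauss]_y f (c + M / K) (y + k) -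
    \int[P n]_x f (c + M / K) (S n x)| <= M^-1.
  by near: n; move/cvgrPdist_le : cd; exact.
have := up (c - M / K) n; rewrite subrK => a1.
have := dn (c + M / K) n; rewrite addrK => a2.
have a3 := gdn (c - M / K); have a4 := gup (c + M / K).
have l1 : Phi (k - (c - M / K - M / K)) <= Phi (k - c) + 2 * M^-1.
  by apply: lip; lra.
have l2 : Phi (k - c) <= Phi (k - (c + M / K + M / K)) + 2 * M^-1.
  by apply: lip; lra.
have -> : e = 5 * M^-1 by rewrite eM; field.
exact: (sandwich_dist a1 a2 a3 a4 h1 h2 l1 l2).
Unshelve. all: by end_near. Qed.

Lemma avg_stdnormal_comp (a b c c' : R) (f : R -> R) : 0 < b -> unitfun f ->
  avg gauss (fun y => y * a + c) (avg gauss (fun y => y * b + c') f) =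
  avg gauss (fun y => y * Num.sqrt (a ^+ 2 + b ^+ 2) + (c + c')) f.
Proof.
move=> b0 uf; have [mf f01] := uf.
have maff (u v : R) : measurable_fun setT (fun z : R => z * u + v).
  by apply: measurable_funD => //; exact: measurable_funM.
apply/funext => x; apply: EFin_inj.
rewrite (avgE gauss (maff a c)); last exact: (unitfun_avg gauss (maff b c') uf).
rewrite (avgE gauss (maff _ (c + c')))//.
under eq_integral do rewrite (avgE gauss (maff b c'))//.
have mG : measurable_fun setT (fun u : R => (f (x + u + (c + c')))%:E).
  apply/measurable_EFinP; apply: measurableT_comp => //.
  by apply: measurable_funD => //; exact: measurable_funD.
have G0 u : (0 <= (f (x + u + (c + c')))%:E)%E.
  by rewrite lee_fin; case/andP: (f01 (x + u + (c + c'))).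
transitivity (\int[gauss]_y \int[gauss]_z (f (x + (a * y + b * z) + (c + c')))%:E)%E.
  apply: eq_integral => y _; apply: eq_integral => z _; congr (f _)%:E; ring.
rewrite (stdnormal_conv a b0 mG G0).
by apply: eq_integral => y _; congr (f _)%:E; ring.
Qed.

(** Variances and drifts add up. The induction starts at one step because the inner scale in
    [avg_stdnormal_comp] must be positive. *)
Lemma iter_avg_stdnormal (a c : R) (f : R -> R) j : 0 < a -> unitfun f ->
  iter j.+1 (avg gauss (fun y => y * a + c)) f =
  avg gauss (fun y => y * (Num.sqrt j.+1%:R * a) + j.+1%:R * c) f.
Proof.
move=> a0 uf; elim: j => [|j IH].
  by rewrite /= sqrtr1 !mul1r.
rewrite iterS IH avg_stdnormal_comp ?mulr_gt0 ?sqrtr_gt0 ?ltr0n//.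
have -> : Num.sqrt (a ^+ 2 + (Num.sqrt j.+1%:R * a) ^+ 2) = Num.sqrt j.+2%:R * a.
  rewrite exprMn sqr_sqrtr// -{1}(mul1r (a ^+ 2)) -mulrDl nat1r sqrtrM//.
  by rewrite sqrtr_sqr gtr0_norm.
by have -> : c + j.+1%:R * c = j.+2%:R * c by rewrite -{1}(mul1r c) -mulrDl nat1r.
Qed.

End normal_cdf.

(** * Central limit theorem under local alternatives *)

Section triangular_array.
Context {R : realType}.
Notation gauss := (normal_prob (0 : R) 1).

Lemma cvg_natV : (n%:R)^-1 @[n --> \oo] --> (0 : R).
Proof.
apply/gtr0_cvgV0; last exact: cvgr_idn.
by exists 1%N => // n /= n1; rewrite ltr0n.
Qed.

(** The normal law is treated as its own trivial alternative: X is the identity, the tangent and t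
    are zero, and the singular set is empty. The drift is added afterwards as a translation. *)
Lemma stdnormal_expansion (C : R) (f f1 f2 : R -> R) : taylor2 C f f1 f2 ->
  exists2 e : nat -> R, e n @[n --> \oo] --> 0 &
    \forall n \near \oo, forall x,
    `| n%:R * (avg gauss (fun y => y / Num.sqrt n%:R) f x - f x) - f2 x / 2 |
      <= e n.
Proof.
move=> tf.
have s0 : sqint gauss (cst 0 : R -> R).
  by apply: (@sqint_bounded _ _ _ _ _ 0) => // x; rewrite normr0.
have [||||||||e e0 en] := @local_expansion _ _ _ gauss (fun=> gauss) id (cst 0)
  (fun=> cst 0) (fun=> set0) (fun=> 0) C 0 f f1 f2 tf sqint_stdnormal_id s0.
- by move=> n; exact: measurable_cst.
- by [].
- apply: nearW => n h uh; rewrite integral_set0 adde0.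
  by apply: eq_integral => y _; rewrite mulr0 addr0 expr1n mulr1.
- exact: stdnormal_mean.
- by rewrite /Rintegral stdnormal_second_moment.
- by under eq_fun do rewrite mul0r; exact: cvg_cst.
- under eq_fun do under eq_integral do rewrite /= subrr expr0n/=.
  by under eq_fun do rewrite integral0; exact: cvg_cst.
- by under eq_fun do rewrite measure0 mulr0; exact: cvg_cst.
exists e => //; near=> n => x.
have : forall x, `| n%:R * (avg gauss (fun y => y / Num.sqrt n%:R) f x - f x) -
       (0 * \int[gauss]_y (y * 0) * f1 x + f2 x / 2) | <= e n by near: n.
by move=> /(_ x); rewrite !mul0r add0r.
Unshelve. all: by end_near. Qed.

Context d (T : measurableType d).

Lemma triangular_array_clt (P0 : probability T R) (Q : nat -> probability T R)
    (X g : T -> R) (w : nat -> T -> R) (N : nat -> set T) (t : nat -> R)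
    (C l : R) (f f1 f2 : R -> R) :
  taylor2 C f f1 f2 -> sqint P0 X -> sqint P0 g ->
  (forall n, measurable_fun setT (w n)) -> (forall n, measurable (N n)) ->
  (\forall n \near \oo, sqrt_density P0 (Q n) (t n) (w n) (N n)) ->
  \int[P0]_y X y = 0 -> \int[P0]_y (X y ^+ 2) = 1 ->
  t n * Num.sqrt n%:R @[n --> \oo] --> l ->
  (\int[P0]_y ((w n y - g y) ^+ 2)%:E @[n --> \oo] --> 0)%E ->
  n%:R * fine (Q n (N n)) @[n --> \oo] --> 0 ->
  iter n (avg (Q n) (fun y => X y / Num.sqrt n%:R)) f 0 @[n --> \oo] -->
    \int[gauss]_y f (y + l * \int[P0]_y (X y * g y)).
Proof.
move=> tf sX sg mw mN dens X0 X1 tl wg QN.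
set k := l * _.
have [e e0 en] := local_expansion tf sX sg mw mN dens X0 X1 tl wg QN.
have [e' e'0 e'n] := stdnormal_expansion tf.
have uf := taylor2_unitfun tf.
have [C0 _ _ _ _ _ r1 _ l2] := tf.
have mX : measurable_fun setT X by case: sX.
(* The last two constants pay for translating the normal step by k / n: C |k| / 2 for the change of
   f''/2, and C k^2 for the first-order Taylor remainder multiplied by n. *)
pose eps n := e n + e' n + (C * `|k| / 2 + C * k ^+ 2) * n%:R^-1.
have eps0 : eps n @[n --> \oo] --> 0.
  rewrite [X in _ --> X](_ : _ = 0 + 0 + (C * `|k| / 2 + C * k ^+ 2) * 0);
    last by rewrite mulr0 !addr0.
  apply: cvgD; first exact: cvgD.
  by apply: cvgM; [exact: cvg_cst|exact: cvg_natV].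
apply/cvgrPdist_le => r r0; near=> n.
have n0 : (0 < n)%N by near: n; exact: nbhs_infty_gt.
have nr0 : 0 < n%:R :> R by rewrite ltr0n.
have nr0' : n%:R != 0 :> R by rewrite gt_eqF.
have sn0 : 0 < Num.sqrt n%:R :> R by rewrite sqrtr_gt0.
have epsr : eps n <= r.
  apply: le_trans (ler_norm _) _; rewrite -[eps n]subr0 distrC.
  by near: n; move/cvgrPdist_le : eps0; exact.
have Un : forall x, `| n%:R * (avg (Q n) (fun y => X y / Num.sqrt n%:R) f x - f x) -
       (k * f1 x + f2 x / 2) | <= e n by near: n.
have Gn : forall x, `| n%:R * (avg gauss (fun y => y / Num.sqrt n%:R) f x - f x) -
       f2 x / 2 | <= e' n by near: n.
pose Y (y : measurableTypeR R) : R := y * (Num.sqrt n%:R)^-1 + k / n%:R.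
have mY : measurable_fun setT Y by apply: measurable_funD => //; exact: measurable_funM.
have VE x : avg gauss Y f x =
    avg gauss (fun y => y / Num.sqrt n%:R) f (x + k / n%:R).
  by apply: eq_Rintegral => y _; rewrite /Y; congr f; ring.
have close x : `|avg (Q n) (fun y => X y / Num.sqrt n%:R) f x - avg gauss Y f x|
    <= eps n / n%:R.
  rewrite ler_pdivlMr// mulrC -[X in X * _](gtr0_norm nr0) -normrM VE.
  set x' := x + k / n%:R.
  have h1 := Un x; have h2 := Gn x'.
  have h3 := l2 x (k / n%:R); have h4 := r1 x (k / n%:R).
  rewrite -/x' in h3 h4.
  have {}h3 : `|f2 x' / 2 - f2 x / 2| <= C * `|k| / 2 * n%:R^-1.
    rewrite -mulrBl normrM (ger0_norm (_ : 0 <= 2^-1)) ?invr_ge0//.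
    rewrite [leRHS]mulrAC ler_wpM2r ?invr_ge0// (le_trans h3)//.
    by rewrite normrM normfV (gtr0_norm nr0) mulrA.
  have {}h4 : `|n%:R * (f x' - f x) - k * f1 x| <= C * k ^+ 2 * n%:R^-1.
    have -> : n%:R * (f x' - f x) - k * f1 x =
      n%:R * (f x' - f x - f1 x * (k / n%:R)) by field.
    rewrite normrM (gtr0_norm nr0).
    have -> : C * k ^+ 2 * n%:R^-1 = n%:R * (C * (k / n%:R) ^+ 2) by field.
    by rewrite ler_pM2l.
  rewrite [X in `|X|](_ : _ =
    (n%:R * (avg (Q n) (fun y => X y / Num.sqrt n%:R) f x - f x) -
       (k * f1 x + f2 x / 2)) -
    (n%:R * (avg gauss (fun y => y / Num.sqrt n%:R) f x' - f x') - f2 x' / 2) -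
    (f2 x' / 2 - f2 x / 2) - (n%:R * (f x' - f x) - k * f1 x)); last by ring.
  rewrite /eps mulrDl addrA.
  rewrite (le_trans (ler_normB _ _))// lerD//.
  rewrite (le_trans (ler_normB _ _))// lerD//.
  by rewrite (le_trans (ler_normB _ _))// lerD.
have mXn : measurable_fun setT (fun y => X y / Num.sqrt n%:R).
  exact: measurable_funM.
have := iter_avg_close n mXn mY uf close 0.
have -> : n%:R * (eps n / n%:R) = eps n by field.
have [j nE] : exists j, n = j.+1 by exists n.-1; rewrite prednK.
have sV0 : 0 < (Num.sqrt n%:R)^-1 :> R by rewrite invr_gt0.
(* An exact identity for each positive n: the scale is sqrt n / sqrt n = 1 and the drift n (k / n) =
   k. *)
have -> : iter n (avg gauss Y) f 0 = \int[gauss]_y f (y + k).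
  have := iter_avg_stdnormal (k / n%:R) j sV0 uf; rewrite -nE => ->.
  rewrite mulfV ?gt_eqF// mulrCA mulfV// mulr1.
  by apply: eq_Rintegral => y _; rewrite mulr1 add0r.
by rewrite distrC => /le_trans; apply.
Unshelve. all: by end_near. Qed.

End triangular_array.

(** * From differentiable curves to triangular arrays *)

Lemma cvg_within_seq (R : realType) (u : nat -> R) (D : set R) (x : R) :
  u n @[n --> \oo] --> x -> (\forall n \near \oo, D (u n)) ->
  u n @[n --> \oo] --> within D (nbhs x).
Proof.
move=> ux Du A /= /ux; rewrite /= /nbhs/= => Au.
by near=> n; have : D (u n) by [near: n]; near: n.
Unshelve. all: by end_near. Qed.

Lemma measurable_sqrtr (R : realType) : measurable_fun setT (@Num.sqrt R).
Proof. by apply: continuous_measurable_fun; exact: sqrt_continuous. Qed.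

Section curve.
Context d (T : measurableType d) (R : realType).
Notation gauss := (normal_prob (0 : R) 1).

(** The function w is chosen so that 1 + t/2 w is the square root of [fine L]. Off N this is the
    root of the density; on N, where [fine] turns +oo into 0, the P0-integral does not see it
    because N is P0-null. *)
Lemma likelihood_ratio_sqrt_density (P P0 : probability T R) (L : T -> \bar R)
    (t : R) : is_likelihood_ratio P P0 L -> t != 0 ->
  sqrt_density P0 P t (fun y => 2 / t * (Num.sqrt (fine (L y)) - 1))
    [set y | L y = +oo%E].
Proof.
move=> [mL L0 P0L PL] t0 h uh; set N := [set y | _].
have [mh h01] := uh.
have mN : measurable N.
  rewrite (_ : N = setT `&` L @^-1` [set +oo%E]); last by rewrite setTI.
  by apply: mL.
have mNC := measurableC mN.
have finL y : (~` N) y -> L y = (fine (L y))%:E.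
  by move=> Ny; rewrite fineK// ge0_fin_numE// lt_neqAle leey andbT; apply/eqP.
have mfL : measurable_fun setT (fun y => fine (L y)).
  exact: measurableT_comp.
have fL0 y : 0 <= fine (L y) by exact: fine_ge0.
have mhE : measurable_fun setT (fun y => (h y)%:E) by exact/measurable_EFinP.
have hE0 y : (0 <= (h y)%:E)%E by rewrite lee_fin; case/andP: (h01 y).
have splitN (mu : probability T R) (F : T -> \bar R) :
    measurable_fun setT F -> (forall y, 0 <= F y)%E ->
    (\int[mu]_y F y = \int[mu]_(y in ~` N) F y + \int[mu]_(y in N) F y)%E.
  move=> mF F0; rewrite -(ge0_integral_setU mu mNC mN) ?setUCl//.
  by apply/disj_setPS => y [].
rewrite splitN//; congr (_ + _)%E.
rewrite (@ge0_integral_density _ _ _ P0 P (~` N) (fun y => fine (L y)))//; last first.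
  move=> A mA AN; apply: (etrans (PL A mA)); rewrite -/N.
  rewrite (_ : A `&` N = set0); last by apply/seteqP; split => // y [/AN].
  by rewrite measure0 adde0; apply: eq_integral => y /[!inE] /AN /finL.
have E y : h y * (1 + t / 2 * (2 / t * (Num.sqrt (fine (L y)) - 1))) ^+ 2 =
    h y * fine (L y).
  rewrite [1 + _](_ : _ = Num.sqrt (fine (L y))); first by rewrite sqr_sqrtr.
  by field.
under [RHS]eq_integral do rewrite E EFinM.
have mF : measurable_fun setT (fun y => (h y)%:E * (fine (L y))%:E)%E.
  by apply: emeasurable_funM => //; exact/measurable_EFinP.
have F0 y : (0 <= (h y)%:E * (fine (L y))%:E)%E by rewrite mule_ge0// lee_fin.
rewrite splitN//.
rewrite [X in (_ + X)%E](null_set_integral _ _ P0L)//; first by rewrite adde0.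
exact: measurable_funTS.
Qed.

(** The extended-real and the real integrand can differ only where L is infinite, which is a P0-null
    set. *)
Lemma Lnorm2_likelihood_ratio (P P0 : probability T R) (L : T -> \bar R)
    (t : R) (g : T -> R) : is_likelihood_ratio P P0 L -> measurable_fun setT g ->
  ('N[P0]_2%:E[(fun y => (2 / t)%:E * (L y `^ 2^-1 - 1) - (g y)%:E)] `^ 2 =
   \int[P0]_y ((2 / t * (Num.sqrt (fine (L y)) - 1) - g y) ^+ 2)%:E)%E.
Proof.
move=> [mL L0 P0L PL] mg; rewrite poweR_Lnorm//; apply: ae_eq_integral => //.
- apply: (measurableT_comp (measurable_poweR _)).
  apply: measurableT_comp => //; apply: emeasurable_funB; last exact/measurable_EFinP.
  apply: emeasurable_funM => //; apply: emeasurable_funB => //.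
  exact: (measurableT_comp (measurable_poweR _)).
- apply/measurable_EFinP; apply: measurable_funX; apply: measurable_funB => //.
  apply: measurable_funM => //; apply: measurable_funB => //.
  apply: (measurableT_comp (f := @Num.sqrt R)); last exact: measurableT_comp.
  exact: measurable_sqrtr.
- exists [set y | L y = +oo%E]; split => //.
    rewrite (_ : [set y | _] = setT `&` L @^-1` [set +oo%E]); last by rewrite setTI.
    by apply: mL.
  move=> y /=; apply: contra_notP => Ly _.
  have LE : L y = (fine (L y))%:E.
    by rewrite fineK// ge0_fin_numE// lt_neqAle leey andbT; apply/eqP.
  have fL0 : 0 <= fine (L y) by exact: fine_ge0.
  set r := fine (L y) in LE fL0 *.
  transitivity ((`|2 / t * (Num.sqrt r - 1) - g y|%:E `^ 2)%E).
    by rewrite LE poweR_EFin powR12_sqrt.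
  by rewrite poweR_EFin powR_mulrn// real_normK// num_real.
Qed.

Variables (PP : set (probability T R)) (P0 : probability T R).
Variables (e : R) (c : R -> probability T R) (g : T -> R).
Hypothesis cg : L2_differentiable_curve PP P0 e c g.

Lemma local_sequence_clt (X : T -> R) (t : nat -> R) (l : R) :
  sqint P0 X -> \int[P0]_y X y = 0 -> \int[P0]_y (X y ^+ 2) = 1 ->
  (forall n, `|t n| < e) -> 0 < l ->
  t n * Num.sqrt n%:R @[n --> \oo] --> l ->
  forall u, \int[iid_prob (c (t n)) n]_x
      \1_(`]u, +oo[%classic : set R) (\sum_(i < n) (X (tnth x i) / Num.sqrt n%:R))
    @[n --> \oo] --> Phi (l * \int[P0]_y (X y * g y) - u).
Proof.
move=> sX X0 X1 te l0 tl.
have [e0 c0 _ g2 [L [LR Lg Lsing]]] := cg.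
have sg := Lfun2_sqint g2.
have t0 : t n @[n --> \oo] --> 0.
  have tls : t n * Num.sqrt n%:R * (Num.sqrt n%:R)^-1 @[n --> \oo] --> 0.
    by rewrite -[X in _ --> X](mulr0 l); exact: (cvgM tl (@cvg_sqrt_natV R)).
  apply: cvg_trans tls; apply: near_eq_cvg.
  exists 1%N => // n /= n0.
  by rewrite /= mulfK// gt_eqF// sqrtr_gt0 ltr0n.
have tpos : \forall n \near \oo, 0 < t n.
  apply: filterS (cvgr_gt l tl 0 l0) => n.
  have := sqrtr_ge0 (n%:R : R); rewrite le0r => /orP[/eqP ->|s0].
    by rewrite mulr0 ltxx.
  by rewrite pmulr_lgt0.
(* The limits defining the curve are taken over nonzero t; positivity of l keeps t n away from the
   value 0 eventually. *)
have tn0 : t n @[n --> \oo] --> (0 : R)^'.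
  apply: cvg_within_seq => //; near=> n.
  have : 0 < t n by near: n.
  by rewrite lt0r => /andP[].
have {}Lg := cvg_comp _ _ tn0 Lg; have {}Lsing := cvg_comp _ _ tn0 Lsing.
pose w n y := 2 / t n * (Num.sqrt (fine (L (t n) y)) - 1).
pose N n := [set y | L (t n) y = +oo%E].
have mL n : measurable_fun setT (L (t n)) by have [] := LR _ (te n).
have mw n : measurable_fun setT (w n).
  apply: measurable_funM => //; apply: measurable_funB => //.
  apply: (measurableT_comp (f := @Num.sqrt R)); last exact: measurableT_comp.
  exact: measurable_sqrtr.
have mN n : measurable (N n).
  rewrite (_ : N n = setT `&` L (t n) @^-1` [set +oo%E]); last by rewrite setTI.
  by apply: mL.
have dens : \forall n \near \oo, sqrt_density P0 (c (t n)) (t n) (w n) (N n).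
  near=> n; apply: likelihood_ratio_sqrt_density; first exact: LR.
  by rewrite gt_eqF//; near: n.
have wg : (\int[P0]_y ((w n y - g y) ^+ 2)%:E @[n --> \oo] --> 0)%E.
  have /fine_cvgP[Nfin Nf] := Lg.
  pose F n := ('N[P0]_2%:E[(fun y => (2 / t n)%:E * (L (t n) y `^ 2^-1 - 1) -
    (g y)%:E)])%E.
  have H : ((fine (F n) * fine (F n))%:E @[n --> \oo] --> 0)%E.
    apply: cvg_EFin; first exact: nearW.
    by rewrite -[X in _ --> X](mulr0 0); exact: (cvgM Nf Nf).
  apply: cvg_trans H; apply: near_eq_cvg; near=> n.
  have LRn := LR _ (te n).
  rewrite -(Lnorm2_likelihood_ratio _ LRn); last by case: sg.
  have Nn : F n \is a fin_num by near: n.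
  rewrite -/(F n).
  rewrite -[X in _ = (X `^ _)%E](fineK Nn) poweR_EFin powR_mulrn -?expr2//.
  by rewrite fine_ge0// Lnorm_ge0.
have QN : n%:R * fine (c (t n) (N n)) @[n --> \oo] --> 0.
  have /fine_cvgP[_ fs] := Lsing.
  (* Writing n = (t n sqrt n)^2 / (t n)^2 turns the o(t^2) bound on the singular mass into the
     o(1/n) bound wanted. *)
  have H : (t n * Num.sqrt n%:R) * (t n * Num.sqrt n%:R) *
      fine (((t n ^+ 2)^-1)%:E * c (t n) (N n))%E @[n --> \oo] --> 0.
    by rewrite -[X in _ --> X](mulr0 (l * l)); exact: (cvgM (cvgM tl tl) fs).
  apply: cvg_trans H; apply: near_eq_cvg; near=> n.
  have tn : 0 < t n by near: n.
  rewrite fineM ?fin_num_measure//=.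
  rewrite -[X in _ = X * _](sqr_sqrtr (ler0n R n)).
  by field; rewrite gt_eqF.
have mX : measurable_fun setT X by case: sX.
have mXn n : measurable_fun setT (fun y => X y / Num.sqrt n%:R).
  exact: measurable_funM.
apply: (portmanteau_gt (P := fun n => iid_prob (c (t n)) n)
  (S := fun n x => \sum_(i < n) (X (tnth x i) / Num.sqrt n%:R)))
  => [n|C f f1 f2 tf].
  exact: (measurable_tuple_sum (mXn n)).
have uf := taylor2_unitfun tf.
have := triangular_array_clt tf sX sg mw mN dens X0 X1 tl wg QN.
apply: cvg_trans; apply: near_eq_cvg; apply: nearW => n.
rewrite iter_avg_iid//.
by apply: eq_Rintegral => x _; rewrite add0r.
Unshelve. all: by end_near. Qed.

End curve.

(** * Critical values and rejection regions of the two tests *)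

Lemma normal_quantile_ge0 (R : realType) (beta : R) :
  2^-1 < beta -> 0 <= normal_quantile beta.
Proof.
move=> b2; rewrite /normal_quantile.
(* The infimum of the empty set is 0 by convention. Otherwise symmetry gives [Phi 0] = 1/2, which
   excludes negative points. *)
have [->|/set0P S0] := eqVneq [set x | beta <= Phi x] set0.
  by rewrite inf0.
apply: lb_le_inf => // x /= bx; rewrite leNgt; apply/negP => x0.
have := Phi_le (ltW x0); have := @Phi_add_PhiN R 0; rewrite oppr0.
by move: bx b2; set a := Phi x; set b := Phi 0; lra.
Qed.

Lemma indic_gt_scale (R : realType) (s u z : R) : 0 < s ->
  \1_(`]u * s, +oo[%classic : set R) z = \1_(`]u, +oo[%classic : set R) (z / s) :> R.
Proof.
by move=> s0; rewrite !indicE !mem_setE !in_itv/= !andbT ltr_pdivlMr.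
Qed.

Lemma indic_gt_norm (R : realType) (u z : R) : 0 <= u ->
  \1_(`]u, +oo[%classic : set R) `|z| =
  \1_(`]u, +oo[%classic : set R) z + \1_(`]u, +oo[%classic : set R) (- z) :> R.
Proof.
move=> u0; rewrite !indicE !mem_setE !in_itv/= !andbT.
have [z0|z0] := leP 0 z.
- have -> : (u < - z) = false by apply/negbTE; rewrite -leNgt; lra.
  by rewrite addr0 ger0_norm.
- have -> : (u < z) = false by apply/negbTE; rewrite -leNgt; lra.
  by rewrite add0r ltr0_norm.
Qed.

Theorem theorem8 (d : measure_display) (T : measurableType d) (R : realType)
    (PP : set (probability T R)) (P0 : probability T R) (hP0 : PP P0)
    (alpha : R) (halpha : 0 < alpha < 1)
    (k : probability T R -> R) (hk : differentiable_at PP P0 k)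
    (ktilde : T -> R) (hktilde : is_canonical_gradient PP P0 k ktilde)
    (hne0 : \int[P0]_x (ktilde x ^+ 2) <> 0)
    (Q : nat -> probability T R) (hQ : local_sequences PP P0 Q) :
  let s := fun n : nat => Num.sqrt n%:R * (k (Q n) - k P0) in
  let theta := limn s in
  [/\ cvgn s,
      ('E_(iid_prob (Q n) n)[@phi1 d T R P0 alpha ktilde n]
        @[n --> \oo] -->
        (Phi (theta / L2norm P0 ktilde - normal_quantile (1 - alpha)))%:E)%E &
      ('E_(iid_prob (Q n) n)[@phi2 d T R P0 alpha ktilde n]
        @[n --> \oo] -->
        (Phi (theta / L2norm P0 ktilde - normal_quantile (1 - alpha / 2))
         + Phi (- (theta / L2norm P0 ktilde)
                - normal_quantile (1 - alpha / 2)))%:E)%E].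
Proof.
have [[[kL2 k0] kder] _ _] := hktilde.
have [t [t0 [l l0 tl] [e [c [g [cg tQ]]]]]] := hQ.
move=> s theta; set sigma := L2norm P0 ktilde.
have sk := Lfun2_sqint kL2.
have sg : sqint P0 g by case: cg => _ _ _ /Lfun2_sqint.
have k2 : 0 < \int[P0]_x (ktilde x ^+ 2).
  by rewrite lt0r Rintegral_ge0 ?andbT//; [exact/eqP|move=> x _; exact: sqr_ge0].
have sigma0 : 0 < sigma by rewrite sqrtr_gt0.
have sigmaE : sigma ^+ 2 = \int[P0]_x (ktilde x ^+ 2) by rewrite sqr_sqrtr// ltW.
have e0 : 0 < e by case: cg.
(* The index 0 is unconstrained in [local_sequences]; the value 0 there puts the whole sequence in
   the domain of the curve. *)
pose tt n := if n is 0%N then 0 else t n.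
have tte n : `|tt n| < e.
  case: n => [|n]; first by rewrite normr0.
  by have [] := tQ n.+1 isT; rewrite ger0_norm// t0.
have ttl : tt n * Num.sqrt n%:R @[n --> \oo] --> l.
  apply: cvg_trans tl; apply: near_eq_cvg.
  by exists 1%N => // -[].
have ttQ n : (0 < n)%N -> c (tt n) = Q n by case: n => // n _; have [] := tQ n.+1 isT.
have tt0 : tt n @[n --> \oo] --> 0.
  have H : tt n * Num.sqrt n%:R * (Num.sqrt n%:R)^-1 @[n --> \oo] --> 0.
    by rewrite -[X in _ --> X](mulr0 l); exact: (cvgM ttl (@cvg_sqrt_natV R)).
  apply: cvg_trans H; apply: near_eq_cvg; exists 1%N => // n /= n0.
  by rewrite mulfK// gt_eqF// sqrtr_gt0 ltr0n.
have ttpos : \forall n \near \oo, 0 < tt n.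
  apply: filterS (cvgr_gt l ttl 0 l0) => n.
  have := sqrtr_ge0 (n%:R : R); rewrite le0r => /orP[/eqP ->|s0].
    by rewrite mulr0 ltxx.
  by rewrite pmulr_lgt0.
have tt0r : tt n @[n --> \oo] --> (0 : R)^'+ by exact: cvg_within_seq.
pose I := \int[P0]_x (ktilde x * g x).
have scvg : s n @[n --> \oo] --> l * I.
  (* The difference quotient of k along the curve converges by the gradient property, a limit from
     the right that [tt0r] makes available. *)
  have H : tt n * Num.sqrt n%:R * ((tt n)^-1 * (k (c (tt n)) - k P0))
      @[n --> \oo] --> l * I.
    exact: (cvgM ttl (cvg_comp _ _ tt0r (kder _ _ _ cg))).
  apply: cvg_trans H; apply: near_eq_cvg; near=> n.
  have n0 : (0 < n)%N by near: n; exact: nbhs_infty_gt.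
  have tn0 : 0 < tt n by near: n.
  rewrite /= /s ttQ//.
  by field; rewrite gt_eqF.
have thetaE : theta = l * I by exact: cvg_lim scvg.
(* The sign a is 1 for the right tail and -1 for the left tail, which reverses the sign of the
   drift. *)
have CLT (a : R) : a ^+ 2 = 1 -> forall u,
    \int[iid_prob (Q n) n]_x \1_(`]u, +oo[%classic : set R)
      (a * test_stat ktilde x / sigma)
    @[n --> \oo] --> Phi (a * (l * I / sigma) - u).
  move=> a1 u; pose X y := a / sigma * ktilde y.
  have sX : sqint P0 X by exact: sqintZ.
  have X0 : \int[P0]_y X y = 0.
    by rewrite RintegralZl ?k0 ?mulr0//; exact: sqint_integrable.
  have X1 : \int[P0]_y (X y ^+ 2) = 1.
    under eq_Rintegral do rewrite exprMn.
    rewrite RintegralZl//; last by case: sk.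
    by rewrite -sigmaE exprMn a1 mul1r exprVn mulVf// expf_eq0/= gt_eqF.
  have := local_sequence_clt (u := u) cg sX X0 X1 tte l0 ttl.
  have -> : l * \int[P0]_y (X y * g y) = a * (l * I / sigma).
    under eq_Rintegral do rewrite -mulrA.
    rewrite RintegralZl//; last exact: (sqint_integrableM sk sg).
    by rewrite -/I; ring.
  apply: cvg_trans; apply: near_eq_cvg; near=> n.
  have n0 : (0 < n)%N by near: n; exact: nbhs_infty_gt.
  rewrite ttQ//; apply: eq_Rintegral => x _; congr (\1_ _ _).
  rewrite /test_stat mulr_sumr mulr_sumr mulr_suml.
  by apply: eq_bigr => i _; rewrite /X; ring.
have mS n : measurable_fun setT (@test_stat d T R ktilde n).
  apply: measurable_funM => //; apply: measurable_tuple_sum.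
  by case: sk.
have mSa a n : measurable_fun setT
    (fun x : n.-tuple T => a * test_stat ktilde x / sigma).
  apply: measurable_funM; last exact: measurable_cst.
  by apply: measurable_funM; [exact: measurable_cst|exact: mS].
have uS a u n : unitfun (fun x : n.-tuple T =>
    \1_(`]u, +oo[%classic : set R) (a * test_stat ktilde x / sigma) : R).
  by apply: (unitfun_comp (mSa a n)); exact: unitfun_indic.
have E1 n : ('E_(iid_prob (Q n) n)[@phi1 d T R P0 alpha ktilde n] =
    (\int[iid_prob (Q n) n]_x
      \1_(`]normal_quantile (1 - alpha), +oo[%classic : set R)
        (1 * test_stat ktilde x / sigma))%:E)%E.
  rewrite unlock Rintegral_unitfunE; last exact: uS.
  apply: eq_integral => x _; congr EFin.
  by rewrite mul1r -indic_gt_scale.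
(* A nonnegative critical value makes the two tails disjoint, so the two-sided indicator is the sum
   of the one-sided ones. *)
have u0 : 0 <= normal_quantile (1 - alpha / 2).
  by apply: normal_quantile_ge0; move: halpha => /andP[_ ?]; lra.
have E2 n : ('E_(iid_prob (Q n) n)[@phi2 d T R P0 alpha ktilde n] =
    (\int[iid_prob (Q n) n]_x
      \1_(`]normal_quantile (1 - alpha / 2), +oo[%classic : set R)
        (1 * test_stat ktilde x / sigma) +
    \int[iid_prob (Q n) n]_x
      \1_(`]normal_quantile (1 - alpha / 2), +oo[%classic : set R)
        (-1 * test_stat ktilde x / sigma))%:E)%E.
  rewrite unlock -RintegralD//; [|exact: unitfun_integrable (uS _ _ _)..].
  rewrite fineK; last first.
    by apply: integrable_fin_num => //; apply: integrable_EFinD; exact: unitfun_integrable (uS _ _ _).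
  apply: eq_integral => x _; congr EFin.
  rewrite mul1r mulN1r -!indic_gt_scale//.
  exact: indic_gt_norm (mulr_ge0 u0 (ltW sigma0)).
rewrite thetaE; split.
- by apply/cvg_ex; exists (l * I).
- under eq_fun do rewrite E1.
  apply/cvg_EFin; first exact: nearW.
  by have := CLT 1 (expr1n _ _) (normal_quantile (1 - alpha)); rewrite mul1r.
- under eq_fun do rewrite E2.
  apply/cvg_EFin; first exact: nearW.
  apply: cvgD.
    by have := CLT 1 (expr1n _ _) (normal_quantile (1 - alpha / 2)); rewrite mul1r.
  have a1 : (-1) ^+ 2 = 1 :> R by rewrite sqrrN expr1n.
  by have := CLT (-1) a1 (normal_quantile (1 - alpha / 2)); rewrite mulN1r.
Unshelve. all: by end_near. Qed.
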